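(* Let $\delta$ be an ordinal satisfying case (D) or case (E), and suppose $2^{\mathrm{cf}(\delta)}=2^{|\delta|}$ and ($2^{<\mathrm{cf}(\delta)}=\mathrm{cf}(\delta)$ or $2^{\mathrm{cf}(\delta)}=\mathrm{cf}(\delta)^+$). Then $\mathrm{ro}(\mathrm{sq}(\mathbb P(\omega^\delta)))\cong\mathrm{Col}(\omega,2^{|\delta|})$.
   Context: With $\kappa=\mathrm{cf}(\delta)$: case (D) means $\delta=\theta+\kappa$ where $\theta\ge\mathrm{cf}(\theta)\ge\kappa>\omega$ or $\theta=0$ (and $\kappa>\omega$); case (E) means $\kappa>\omega$ and $\delta$ is the supremum of a strictly increasing $\kappa$-sequence of ordinals each of cofinality $\kappa$. $\mathbb P(\omega^\delta)$ is the poset of subsets of $\omega^\delta$ order-isomorphic to $\omega^\delta$, ordered by $\subset$; $\mathrm{sq}$ is separative quotient; $\mathrm{ro}$ is Boolean completion; $\mathrm{Col}(\omega,\kappa)$ is the Boolean completion of $\langle{}^{<\omega}\kappa,\supset\rangle$. *)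

(* Defs.v *)
(* Ordinals are modelled as well-ordered types; cardinals via
   injections/bijections between types; power sets as (T -> Prop). *)
From Stdlib Require Import List Arith.
Import ListNotations.
Set Implicit Arguments.

Definition WO {T : Type} (lt : T -> T -> Prop) : Prop :=
  (forall x, ~ lt x x) /\
  (forall x y z, lt x y -> lt y z -> lt x z) /\
  (forall x y, lt x y \/ x = y \/ lt y x) /\
  well_founded lt.

Definition ord_iso {A B : Type} (ltA : A -> A -> Prop) (ltB : B -> B -> Prop) : Prop :=
  exists f : A -> B,
    (forall x y, f x = f y -> x = y) /\ (forall y, exists x, f x = y) /\
    (forall x y, ltA x y <-> ltB (f x) (f y)).

Definition restr {T : Type} (lt : T -> T -> Prop) (S : T -> Prop) :
  {x | S x} -> {x | S x} -> Prop :=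
  fun a b => lt (proj1_sig a) (proj1_sig b).

Definition sum_lt {A B : Type} (ltA : A -> A -> Prop) (ltB : B -> B -> Prop)
  (x y : A + B) : Prop :=
  match x, y with
  | inl a, inl a' => ltA a a'
  | inl _, inr _ => True
  | inr _, inl _ => False
  | inr b, inr b' => ltB b b'
  end.

Definition le_card (A B : Type) : Prop :=
  exists f : A -> B, forall x y, f x = f y -> x = y.
Definition lt_card (A B : Type) : Prop := le_card A B /\ ~ le_card B A.
Definition eq_card (A B : Type) : Prop :=
  exists f : A -> B, (forall x y, f x = f y -> x = y) /\ (forall y, exists x, f x = y).

Definition cofinal {T : Type} (lt : T -> T -> Prop) (S : T -> Prop) : Prop :=
  forall x, exists y, S y /\ (lt x y \/ x = y).
Definition cf_ge {T : Type} (lt : T -> T -> Prop) (K : Type) : Prop :=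
  forall S, cofinal lt S -> le_card K {x | S x}.
Definition cf_le {T : Type} (lt : T -> T -> Prop) (K : Type) : Prop :=
  exists S, cofinal lt S /\ le_card {x | S x} K.
Definition cf_card {T : Type} (lt : T -> T -> Prop) (K : Type) : Prop :=
  cf_ge lt K /\ cf_le lt K.
Definition initial_ordinal {K : Type} (ltK : K -> K -> Prop) : Prop :=
  WO ltK /\ forall a : K, lt_card {b | ltK b a} K.
Definition is_cof {D K : Type} (ltD : D -> D -> Prop) (ltK : K -> K -> Prop) : Prop :=
  initial_ordinal ltK /\ cf_card ltD K.

(* ---------- cases (D) and (E), with kappa = cf(delta) ---------- *)
Definition caseD {D K : Type} (ltD : D -> D -> Prop) (ltK : K -> K -> Prop) : Prop :=
  lt_card nat K /\
  exists (Th : Type) (ltT : Th -> Th -> Prop),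
    WO ltT /\ ord_iso (sum_lt ltT ltK) ltD /\
    ((Th -> False) \/ cf_ge ltT K).

Definition caseE {D K : Type} (ltD : D -> D -> Prop) (ltK : K -> K -> Prop) : Prop :=
  lt_card nat K /\
  exists f : K -> D,
    (forall i j, ltK i j -> ltD (f i) (f j)) /\
    (forall x, exists i, ltD x (f i)) /\
    (forall i, cf_card (restr ltD (fun y => ltD y (f i))) K).

(* 2^{<kappa} = kappa  (2^{<kappa} = sup_{alpha<kappa} 2^{|alpha|}) *)
Definition two_lt_eq {K : Type} (ltK : K -> K -> Prop) : Prop :=
  (forall a : K, le_card ({b | ltK b a} -> Prop) K) /\
  (forall C : Type, (forall a : K, le_card ({b | ltK b a} -> Prop) C) -> le_card K C).

Definition two_pow_succ (K : Type) : Prop :=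
  lt_card K (K -> Prop) /\
  (forall C : Type, lt_card K C -> le_card (K -> Prop) C).

Definition OmegaPow {D : Type} (ltD : D -> D -> Prop) : Type :=
  {f : D -> nat | exists l : list D, forall x, f x <> 0 -> In x l}.
Definition opw_lt {D : Type} (ltD : D -> D -> Prop) (f g : OmegaPow ltD) : Prop :=
  exists x, proj1_sig f x < proj1_sig g x /\
    forall y, ltD x y -> proj1_sig f y = proj1_sig g y.

Arguments opw_lt {D} ltD f g.

Record Preord := { car : Type; le : car -> car -> Prop }.

Definition Pomega {D : Type} (ltD : D -> D -> Prop) : Preord :=
  {| car := {A : OmegaPow ltD -> Prop | ord_iso (restr (opw_lt ltD) A) (opw_lt ltD)};
     le := fun A B => forall x, proj1_sig A x -> proj1_sig B x |}.

Definition compat (P : Preord) (p q : car P) : Prop :=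
  exists r, le P r p /\ le P r q.
Definition sep_le (P : Preord) (p q : car P) : Prop :=
  forall r, le P r p -> compat P r q.
Definition sep_cls (P : Preord) (p : car P) : car P -> Prop :=
  fun q => sep_le P p q /\ sep_le P q p.

Definition sq (P : Preord) : Preord :=
  {| car := {S : car P -> Prop | exists p, S = sep_cls P p};
     le := fun S T => exists p q, proj1_sig S = sep_cls P p /\
                                  proj1_sig T = sep_cls P q /\ sep_le P p q |}.

(* Boolean completion: regular open subsets of P (down-set topology) *)
Definition regular_open (P : Preord) (U : car P -> Prop) : Prop :=
  forall p, U p <-> (forall q, le P q p -> exists r, le P r q /\ U r).
Definition ro (P : Preord) : Type := {U : car P -> Prop | regular_open P U}.
Definition ro_le (P : Preord) (U V : ro P) : Prop :=
  forall x, proj1_sig U x -> proj1_sig V x.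

(* isomorphism of complete Boolean algebras = order isomorphism *)
Definition cba_iso (P Q : Preord) : Prop :=
  exists f : ro P -> ro Q,
    (forall x y, f x = f y -> x = y) /\ (forall y, exists x, f x = y) /\
    (forall x y, ro_le x y <-> ro_le (f x) (f y)).

Definition ColPoset (X : Type) : Preord :=
  {| car := list X; le := fun s t => exists u, s = t ++ u |}.

(* Main.v *)
Require Import Defs.
From Stdlib Require Import List Arith Lia.
From Stdlib Require Cantor.
From mathcomp Require Import ssreflect ssrfun ssrbool eqtype boolp.
From mathcomp Require wochoice classical_sets.
Import ListNotations.
Set Implicit Arguments.
Unset Strict Implicit.

(** Write kappa = cf(delta). The blocks of omega^delta are points or have cofinality at least
    kappa, so a copy of omega^delta is large in unboundedly many blocks, and this set of blocks
    can be thinned out at will: almost disjoint sets in kappa give incompatible copies. A poset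
    of size at most lambda = 2^kappa contains Col(omega, lambda) densely as soon as it has
    countably many antichains such that every condition meets lambda many elements of one of
    them; so it suffices to find almost disjoint families with this property on kappa.

    Let (g w), w in W, be an eventually increasing unbounded family of functions on kappa of
    minimal length. Going from x down to the least b with x <= g w b, where w is the first
    index that makes this regressive, and repeating, one gets descending sequences of ordinals.
    As these are finite, an unbounded set X must, at some finite stage, see at least kappa many
    first indices; then a function rho that depends on few parameters only has kappa many
    unbounded fibres on X. A selector of these fibres has a height in W (the least l such that
    it lies below g l o rho), and the possible heights contain all l of cofinality kappa that
    are closed under some function W -> W. These are more than kappa many, which suffices if
    2^kappa = kappa^+. If 2^(<kappa) = kappa, one colors W a la Solovay, so that the height may
    name any of W many parameters; W many functions on kappa are enough to let one of them
    take all values on rho(X), and the function that is named codes a subset of kappa by its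
    initial segments. *)

(** * Cardinals and well-orders *)

(** The difficulty is uniformity: almost disjoint sets inside one unbounded set are not enough,
    since countably many families have to serve all unbounded sets at once. The sequence of first
    indices depends on X, but sets with different sequences of equal length are almost disjoint, so
    the length alone numbers the family. Uncountability of kappa drives both halves: fewer than
    kappa labels at each finite stage would be fewer than kappa altogether, so some point would
    escape all exceptional bounded sets and descend forever; and every map of kappa into itself has
    unboundedly many closure points, which is what lets the blocks of a copy be thinned out. The
    length of W is the bounding number of kappa; minimality makes it regular and longer than kappa.
    It may exceed kappa^+, and then a segment of W may hold more than kappa heights. To list the
    candidates for a height by codes in kappa, heights are taken along continuous images of N =
    kappa^+ in W, and W many such images suffice for all functions on W. *)

Lemma le_card_refl (A : Type) : le_card A A.
Proof. by exists id. Qed.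

Lemma le_card_trans (A B C : Type) : le_card A B -> le_card B C -> le_card A C.
Proof.
move=> [f fi] [g gi]; exists (fun x => g (f x)) => x y /gi; exact: fi.
Qed.

Lemma le_card_sig (A B : Type) (P : A -> Prop) (Q : B -> Prop) (f : A -> B) :
  (forall x, P x -> Q (f x)) ->
  (forall x y, P x -> P y -> f x = f y -> x = y) ->
  le_card {x | P x} {y | Q y}.
Proof.
move=> fQ fi.
exists (fun u => exist Q (f (sval u)) (fQ _ (proj2_sig u))).
case=> x Px [y Py] /= [] /(fi _ _ Px Py) exy; subst y.
by congr exist; exact: Prop_irrelevance.
Qed.

Lemma le_card_sub (A : Type) (P Q : A -> Prop) :
  (forall x, P x -> Q x) -> le_card {x | P x} {x | Q x}.
Proof. by move=> PQ; apply: (@le_card_sig _ _ P Q id). Qed.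

Lemma le_card_sigT (A : Type) (P : A -> Prop) : le_card {x | P x} A.
Proof.
exists sval; case=> x Px [y Py] /= exy; subst y.
by congr exist; exact: Prop_irrelevance.
Qed.

Lemma sig_inj_on (A B : Type) (P : A -> Prop) (b0 : B) :
  le_card {x | P x} B ->
  exists f : A -> B, forall x y, P x -> P y -> f x = f y -> x = y.
Proof.
move=> [f fi].
exists (fun x => match pselect (P x) with
  | left p => f (exist _ x p) | right _ => b0 end) => x y Px Py.
case: pselect => // p; case: pselect => // q /fi; by case.
Qed.

Lemma surj_on_le_card (A B : Type) (P : A -> Prop) (Q : B -> Prop) (f : A -> B) :
  (forall y, Q y -> exists x, P x /\ f x = y) -> le_card {y | Q y} {x | P x}.
Proof.
move=> fs.
have h (u : {y | Q y}) : exists v : {x | P x}, f (sval v) = sval u.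
  by case: u => y Qy; have [x [Px e]] := fs _ Qy; exists (exist _ x Px).
have [g gP] := choice h.
exists g => u v e; have := gP u; rewrite e gP.
case: u v {e} => [x Px] [y Py] /= exy; subst y.
by congr exist; exact: Prop_irrelevance.
Qed.

Theorem Cantor_Bernstein (A B : Type) :
  le_card A B -> le_card B A -> eq_card A B.
Proof.
move=> [f fi] [g gi].
(* The points whose backward orbit ends in A \ g(B) *)
pose Z := fix Z n a := match n with
  | 0 => forall b, g b <> a
  | S n => exists a', a = g (f a') /\ Z n a' end.
pose C a := exists n, Z n a.
have nC a : ~ C a -> exists b, g b = a.
  move=> nCa; apply: contrapT => h; apply: nCa; exists 0 => b gb.
  by apply: h; exists b.
have h a : exists b, (C a -> b = f a) /\ (~ C a -> g b = a).
  have [Ca|nCa] := EM (C a); first by exists (f a).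
  by have [b gb] := nC _ nCa; exists b.
have [k kP] := choice h.
have cross x y : C x -> ~ C y -> k x = k y -> False.
  move=> Cx nCy e; apply: (nCy); case: (Cx) => n Zn; exists (S n); exists x.
  by split=> //; rewrite -((kP x).1 Cx) e ((kP y).2 nCy).
exists k; split=> [x y e|b].
  have [Cx|nCx] := EM (C x); have [Cy|nCy] := EM (C y).
  - by apply: fi; rewrite -((kP x).1 Cx) -((kP y).1 Cy).
  - by case: (cross _ _ Cx nCy e).
  - by case: (cross _ _ Cy nCx); rewrite e.
  - by rewrite -((kP x).2 nCx) e ((kP y).2 nCy).
have [[[|n] /= Zn]|nCb] := EM (C (g b)).
- by case: (Zn b).
- case: Zn => a [/gi -> Za]; exists a; apply: (kP a).1; by exists n.
- by exists (g b); apply: gi; exact: (kP _).2.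
Qed.

(** ** Well-orders *)

(** The second premise says that [R a] sees a function only below a. So the recursion may pass total
    functions, filled up with the default [b0] outside the predecessors of a. *)
Lemma wf_choice (A B : Type) (lt : A -> A -> Prop) (R : A -> (A -> B) -> B -> Prop) :
  inhabited B -> well_founded lt ->
  (forall a g h b, (forall x, lt x a -> g x = h x) -> R a g b -> R a h b) ->
  (forall a g, (forall x, lt x a -> R x g (g x)) -> exists b, R a g b) ->
  exists f, forall a, R a f (f a).
Proof.
move=> [b0] wf ext ex.
have sel (a : A) (g : A -> B) : exists b, (exists c, R a g c) -> R a g b.
  by have [[c Rc]|n] := EM (exists c, R a g c); [exists c | exists b0].
pose G (a : A) (g : A -> B) : B := sval (cid (sel a g)).
have GP a g : (exists c, R a g c) -> R a g (G a g) by exact: (svalP (cid (sel a g))).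
pose up a (r : forall x, lt x a -> B) x :=
  match pselect (lt x a) with left h => r x h | right _ => b0 end.
pose F (a : A) (r : forall x, lt x a -> B) : B := G a (up a r).
pose f := Fix wf (fun _ => B) F.
have fE a : f a = G a (up a (fun x _ => f x)).
  rewrite /f Fix_eq // => x r s rs; congr (G x _).
  by apply: funext => y; rewrite /up; case: pselect.
exists f => a; elim/(well_founded_ind wf): a => a IH.
have upf x : lt x a -> up a (fun x _ => f x) x = f x by rewrite /up; case: pselect.
apply: (ext _ _ _ _ upf); rewrite fE; apply: GP.
have [b Rb] := ex a f IH; exists b; apply: ext Rb => x /upf; by [].
Qed.

Section WellOrder.
Variables (A : Type) (lt : A -> A -> Prop) (woA : WO lt).

Lemma wo_irr x : ~ lt x x. Proof. by case: woA => h _; exact: h. Qed.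

Lemma wo_trans x y z : lt x y -> lt y z -> lt x z.
Proof. by case: woA => _ [h _]; exact: h. Qed.

Lemma wo_tri x y : lt x y \/ x = y \/ lt y x.
Proof. by case: woA => _ [_ [h _]]; exact: h. Qed.

Lemma wo_wf : well_founded lt.
Proof. by case: woA => _ [_ [_ h]]. Qed.

Lemma wo_asym x y : lt x y -> ~ lt y x.
Proof. by move=> xy yx; exact: (wo_irr (wo_trans xy yx)). Qed.

Lemma wo_nlt x y : ~ lt x y -> x = y \/ lt y x.
Proof. by case: (wo_tri x y) => [|[]]; auto. Qed.

Lemma wo_lt_le x y z : lt x y -> ~ lt z y -> lt x z.
Proof. by move=> xy /wo_nlt [->//|]; exact: wo_trans. Qed.

Lemma wo_le_lt x y z : ~ lt y x -> lt y z -> lt x z.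
Proof. by move=> /wo_nlt [->//|xy yz]; exact: wo_trans yz. Qed.

Lemma wo_le_trans x y z : ~ lt y x -> ~ lt z y -> ~ lt z x.
Proof. by move=> yx zy zx; apply: yx; apply: wo_le_lt zx. Qed.

Lemma wo_le_antisym x y : ~ lt y x -> ~ lt x y -> x = y.
Proof. by move=> h /wo_nlt []. Qed.

Lemma wo_min (P : A -> Prop) :
  (exists x, P x) -> exists x, P x /\ forall y, P y -> ~ lt y x.
Proof.
case=> x0; elim/(well_founded_ind wo_wf): x0 => x IH Px.
have [[y [Py yx]]|n] := EM (exists y, P y /\ lt y x); first exact: IH Py.
by exists x; split=> // y Py yx; apply: n; exists y.
Qed.

Definition wo_max x y := if pselect (lt x y) then y else x.

Lemma wo_max_l x y : ~ lt (wo_max x y) x.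
Proof.
rewrite /wo_max; case: (pselect (lt x y)) => h; [exact: wo_asym|exact: wo_irr].
Qed.

Lemma wo_max_r x y : ~ lt (wo_max x y) y.
Proof.
by rewrite /wo_max; case: (pselect (lt x y)) => h //; exact: wo_irr.
Qed.

Lemma wo_max_lt x y z : lt x z -> lt y z -> lt (wo_max x y) z.
Proof. by rewrite /wo_max; case: (pselect (lt x y)). Qed.

Lemma incr_inj (B : Type) (ltB : B -> B -> Prop) (f : A -> B) :
  (forall x, ~ ltB x x) -> (forall x y, lt x y -> ltB (f x) (f y)) ->
  forall x y, f x = f y -> x = y.
Proof.
move=> irr fi x y e; case: (wo_tri x y) => [/fi|[//|/fi]]; rewrite e => h;
 by case: (irr _ h).
Qed.

Lemma incr_ge (f : A -> A) :
  (forall x y, lt x y -> lt (f x) (f y)) -> forall x, ~ lt (f x) x.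
Proof.
move=> fi x; elim/(well_founded_ind wo_wf): x => x IH h.
exact: (IH _ h (fi _ _ h)).
Qed.

End WellOrder.

Lemma WO_sig (A : Type) (lt : A -> A -> Prop) (P : A -> Prop) :
  WO lt -> WO (restr lt P).
Proof.
move=> h; split; [|split; [|split]].
- by move=> x; exact: (wo_irr h).
- by move=> x y z; exact: (wo_trans h).
- move=> [x Px] [y Py]; case: (wo_tri h x y) => [|[e|]]; auto.
  by right; left; subst y; congr exist; exact: Prop_irrelevance.
- move=> u; have [x e] : exists x, x = sval u by exists (sval u).
  elim/(well_founded_ind (wo_wf h)): x u e => x IH u e; constructor=> v vu.
  by apply: (IH (sval v)) => //; rewrite e.
Qed.

(** Each x goes to the least b above all earlier values; [None] records that B is exhausted, and the
    first such point is the a of the second alternative. *)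
Theorem wo_compare (A B : Type) (ltA : A -> A -> Prop) (ltB : B -> B -> Prop) :
  WO ltA -> WO ltB ->
  (exists f : A -> B, (forall x y, ltA x y -> ltB (f x) (f y)) /\
     (forall x b, ltB b (f x) -> exists y, f y = b)) \/
  (exists (a : A) (g : B -> A), (forall x y, ltB x y -> ltA (g x) (g y)) /\
     (forall b, ltA (g b) a) /\ (forall x, ltA x a -> exists b, g b = x)).
Proof.
move=> hA hB.
pose above a (g : A -> option B) b :=
  forall x, ltA x a -> exists b', g x = Some b' /\ ltB b' b.
pose R a (g : A -> option B) (o : option B) := match o with
  | Some b => above a g b /\ forall b', above a g b' -> ~ ltB b' b
  | None => forall b, ~ above a g b end.
have aboveE a g h b : (forall x, ltA x a -> g x = h x) -> above a g b -> above a h b.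
  by move=> gh ab x xa; rewrite -gh //; exact: ab.
have [f fP] : exists f, forall a, R a f (f a).
  apply: (@wf_choice _ _ ltA R (inhabits None) (wo_wf hA)) => [a g h [b|] gh /=|a g _].
  - move=> [ab mb]; split; first exact: aboveE ab.
    by move=> b' ab'; apply: mb; apply: aboveE ab' => x /gh.
  - by move=> n b ab; apply: (n b); apply: aboveE ab => x /gh.
  have [ex|n] := EM (exists b, above a g b).
    by have [b [ab mb]] := wo_min hB ex; exists (Some b).
  by exists None => b ab; apply: n; exists b.
have [[a0 na0]|sm] := EM (exists a, f a = None).
  right; have [a [fa ma]] := wo_min hA (ex_intro (fun a => f a = None) _ na0).
  have fS x : ltA x a -> exists b, f x = Some b.
    by move=> xa; case e: (f x) => [b|]; [exists b | case: (ma _ e xa)].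
  have onto b : exists x, ltA x a /\ f x = Some b.
    have := fP a; rewrite fa => /(_ b).
    move=> nab; apply: contrapT => n; apply: nab => x xa.
    elim/(well_founded_ind (wo_wf hA)): x xa => x IH xa.
    have [c fx] := fS _ xa; exists c; split=> //.
    have := fP x; rewrite fx => -[ac mc].
    case: (wo_tri hB c b) => [//|[e|bc]]; first by case: n; exists x; split=> //; rewrite fx e.
    case: (mc b _ bc) => y yx; apply: (IH y yx); exact: (wo_trans hA) yx xa.
  have [g gP] := choice onto.
  exists a, g; split; [|split].
  - move=> x y xy; have [gx fx] := gP x; have [gy fy] := gP y.
    case: (wo_tri hA (g x) (g y)) => [//|[e|h]].
      by move: fy; rewrite -e fx => -[e']; subst y; case: (wo_irr hB xy).
    have := fP (g x); rewrite fx => -[/(_ _ h) [b' []]].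
    rewrite fy => -[<-] yx; by case: (wo_asym hB xy).
  - by move=> b; have [] := gP b.
  - move=> x xa; have [b fx] := fS _ xa; exists b; have [gb fb] := gP b.
    have key u v : f u = Some b -> f v = Some b -> ltA u v -> False.
      move=> fu fv uv; have := fP v; rewrite fv => -[/(_ _ uv) [b' []]].
      rewrite fu => -[<-] h _; exact: (wo_irr hB h).
    by case: (wo_tri hA (g b) x) => [/key|[//|/key]] h; case: h.
left.
have fS x : exists b, f x = Some b.
  by case e: (f x) => [b|]; [exists b | case: sm; exists x].
have [g gP] := choice fS.
exists g; split.
  move=> x y xy; have := fP y; rewrite gP => -[/(_ _ xy) [b' []]].
  by rewrite gP => -[<-].
move=> x b; elim/(well_founded_ind (wo_wf hA)): x => x IH bx.
apply: contrapT => n.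
have := fP x; rewrite gP => -[ax mx]; apply: (mx b _ bx) => y yx.
exists (g y); split; first exact: gP.
case: (wo_tri hB (g y) b) => [//|[e|h]]; first by case: n; exists y.
by case: n; exact: (IH y).
Qed.

Theorem zermelo (T : Type) : exists lt : T -> T -> Prop, WO lt.
Proof.
elim/Peq: T => T; have [R Rwo] := wochoice.well_ordering_principle T.
have mn (P : T -> Prop) : (exists x, P x) ->
    exists z, P z /\ (forall x, P x -> R z x) /\ forall y, P y -> (forall x, P x -> R y x) -> z = y.
  case=> x Px; have [|z [[zP zl] zu]] := Rwo (fun x => `[<P x>]).
    by exists x; apply/asboolP.
  exists z; split; first exact/asboolP.
  split; first by move=> y Py; apply: zl; apply/asboolP.
  move=> y Py yl; apply: zu; split; first exact/asboolP.
  by move=> w /asboolP; exact: yl.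
have rr x : R x x.
  by have [|z [-> [h _]]] := mn (fun y => y = x); [exists x | exact: h].
have anti x y : R x y -> R y x -> x = y.
  move=> xy yx; have [|z [_ [_ u]]] := mn (fun w => w = x \/ w = y).
    by exists x; left.
  transitivity z; [symmetry|]; apply: u; auto.
  - by move=> w [->|->].
  - by move=> w [->|->].
have tot x y : R x y \/ R y x.
  have [|z [[->|->] [h _]]] := mn (fun w => w = x \/ w = y); first by exists x; left.
  - by left; apply: h; right.
  - by right; apply: h; left.
have tr x y z : R x y -> R y z -> R x z.
  move=> xy yz; have [|w [Pw [h _]]] := mn (fun w => w = x \/ w = y \/ w = z).
    by exists x; left.
  have wx : R w x by apply: h; left.
  have wy : R w y by apply: h; right; left.
  have wz : R w z by apply: h; right; right.
  case: Pw wx wy wz => [->//|[->|->]] wx wy wz.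
  - by rewrite (anti _ _ xy wx).
  - by rewrite (anti _ _ yz wy) in xy; rewrite (anti _ _ xy wx).
exists (fun x y => R x y /\ x <> y); split; [|split; [|split]].
- by move=> x [].
- move=> x y z [xy nxy] [yz nyz]; split; first exact: tr yz.
  by move=> e; subst z; apply: nxy; apply: anti.
- move=> x y; have [e|n] := EM (x = y); first by auto.
  by case: (tot x y) => h; [left | right; right]; split=> // e; apply: n.
- move=> x; apply: contrapT => nx.
  have [|z [nz [zl _]]] := mn (fun x => ~ Acc (fun x y => R x y /\ x <> y) x).
    by exists x.
  apply: nz; constructor=> y [yz nyz]; apply: contrapT => ny.
  by apply: nyz; apply: anti => //; exact: zl.
Qed.

Lemma le_card_total (A B : Type) : le_card A B \/ le_card B A.
Proof.
have [ltA hA] := zermelo A; have [ltB hB] := zermelo B.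
case: (wo_compare hA hB) => [[f [fi _]]|[a [g [gi _]]]].
- by left; exists f; exact: (incr_inj hA (wo_irr hB)).
- by right; exists g; exact: (incr_inj hB (wo_irr hA)).
Qed.

Lemma nle_card (A B : Type) : ~ le_card A B -> le_card B A.
Proof. by case: (le_card_total A B). Qed.

(** This is why a set is a copy as soon as it contains one: no increasing self-map of a well-order
    goes below the identity, so neither of the two orders can be a proper initial segment of the
    other. *)
Lemma ord_iso_of_embedding (A : Type) (lt : A -> A -> Prop) (P : A -> Prop) (f : A -> A) :
  WO lt -> (forall x y, lt x y -> lt (f x) (f y)) -> (forall x, P (f x)) ->
  ord_iso (restr lt P) lt.
Proof.
move=> h fi fP; have hP := WO_sig P h.
pose F x : {x | P x} := exist _ (f x) (fP x).
case: (wo_compare hP h) => [[g [gi gd]]|[a [g [gi [ga _]]]]].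
  exists g; split; first exact: (incr_inj hP (wo_irr h)).
  split.
    move=> y; apply: contrapT => n.
    have gy u : lt (g u) y.
      case: (wo_tri h (g u) y) => [//|[e|/gd [v e]]]; case: n; [by exists u|by exists v].
    apply: (incr_ge h (f := fun x => g (F x)) _ (gy (F y))) => x z xz.
    by apply: gi; exact: fi.
  move=> u v; split; first exact: gi.
  move=> guv; case: (wo_tri hP u v) => [//|[e|/gi vu]].
    by subst v; case: (wo_irr h guv).
  by case: (wo_asym h guv).
exfalso; apply: (incr_ge hP (f := fun u => g (sval u)) _ (x := a)) => [u v uv|].
  by apply: gi.
exact: ga.
Qed.

(** * Squares and lists of infinite types *)

Lemma le_card_prod (A B C D : Type) :
  le_card A B -> le_card C D -> le_card (A * C) (B * D).
Proof.
move=> [f fi] [g gi]; exists (fun u => (f u.1, g u.2)).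
by move=> [x y] [x' y'] [/fi /= -> /gi /= ->].
Qed.

Lemma nat_prod_nat : le_card (nat * nat) nat.
Proof.
exists Cantor.to_nat => x y e.
by rewrite -(Cantor.cancel_of_to x) e Cantor.cancel_of_to.
Qed.

Lemma hilbert_hotel (B : Type) : le_card nat B -> le_card (option B) B.
Proof.
move=> [f fi].
have h (o : option B) : exists b, match o with
    | None => b = f 0
    | Some c => (forall n, f n = c -> b = f (S n)) /\ ((forall n, f n <> c) -> b = c)
  end.
  case: o => [c|]; last by exists (f 0).
  have [[n fn]|nr] := EM (exists n, f n = c).
    exists (f (S n)); split=> [m fm|/(_ n)] //.
    by congr (f (S _)); apply: fi; rewrite fm.
  by exists c; split=> // n fn; case: nr; exists n.
have [g gP] := choice h.
have g0 : g None = f 0 by exact: (gP None).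
have g1 c n : f n = c -> g (Some c) = f (S n) by exact: (gP (Some c)).1.
have g2 c : (forall n, f n <> c) -> g (Some c) = c by exact: (gP (Some c)).2.
have d c : (exists n, f n = c) \/ (forall n, f n <> c).
  by have [|n] := EM (exists n, f n = c); [left | right => m fm; apply: n; exists m].
exists g => -[c|] [c'|] //; rewrite ?g0.
- case: (d c) => [[n fn]|nc]; case: (d c') => [[n' fn']|nc'].
  + by rewrite (g1 _ _ fn) (g1 _ _ fn') => /fi [e]; rewrite -fn -fn' e.
  + by rewrite (g1 _ _ fn) (g2 _ nc') => e; case: (nc' _ e).
  + by rewrite (g2 _ nc) (g1 _ _ fn') => e; case: (nc (S n')).
  + by rewrite (g2 _ nc) (g2 _ nc') => ->.
- case: (d c) => [[n fn]|nc]; first by rewrite (g1 _ _ fn) => /fi.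
  by rewrite (g2 _ nc) => e; case: (nc 0).
- case: (d c') => [[n fn]|nc]; first by rewrite (g1 _ _ fn) => /fi.
  by rewrite (g2 _ nc) => e; case: (nc 0).
Qed.

Definition lex (A B : Type) (ltA : A -> A -> Prop) (ltB : B -> B -> Prop) (u v : A * B) :=
  ltA u.1 v.1 \/ u.1 = v.1 /\ ltB u.2 v.2.

Lemma WO_lex (A B : Type) (ltA : A -> A -> Prop) (ltB : B -> B -> Prop) :
  WO ltA -> WO ltB -> WO (lex ltA ltB).
Proof.
move=> hA hB; split; [|split; [|split]].
- by move=> [x y] [|[_]] /=; exact: wo_irr.
- move=> [x y] [x' y'] [x'' y''] [h|[/= -> h]] [h'|[/= e h']].
  + left; exact: (wo_trans hA) h h'.
  + by left; rewrite /= -e.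
  + by left.
  + right; split=> //; exact: (wo_trans hB) h h'.
- move=> [x y] [x' y'].
  case: (wo_tri hA x x') => [h|[e|h]]; first by left; left.
    subst x'; case: (wo_tri hB y y') => [h|[e|h]]; first by left; right.
      by right; left; rewrite e.
    by right; right; right.
  by right; right; left.
- move=> [x y]; elim/(well_founded_ind (wo_wf hA)): x y => x IHx y.
  elim/(well_founded_ind (wo_wf hB)): y => y IHy.
  by constructor=> -[x' y'] [/= h|[/= -> h]]; [exact: IHx | exact: IHy].
Qed.

Lemma WO_pull (A B : Type) (lt : B -> B -> Prop) (f : A -> B) :
  (forall x y, f x = f y -> x = y) -> WO lt -> WO (fun x y => lt (f x) (f y)).
Proof.
move=> fi h; split; [|split; [|split]].
- by move=> x; exact: (wo_irr h).
- by move=> x y z; exact: (wo_trans h).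
- by move=> x y; case: (wo_tri h (f x) (f y)) => [|[/fi|]]; auto.
- move=> x; have [b e] : exists b, b = f x by exists (f x).
  elim/(well_founded_ind (wo_wf h)): b x e => b IH x e; constructor=> y yx.
  by apply: (IH (f y)) => //; rewrite e.
Qed.

Lemma le_card_seg_closed (A : Type) (lt : A -> A -> Prop) (m : A) :
  le_card {x | lt x m \/ x = m} (option {x | lt x m}).
Proof.
exists (fun u => match pselect (lt (sval u) m) with
  | left h => Some (exist _ (sval u) h) | right _ => None end).
case=> x hx [y hy] /=; case: pselect => h; case: pselect => h' //.
  case=> e; subst y; congr exist; exact: Prop_irrelevance.
case: hx => // e _; case: hy => // e'; move: (h) (h'); subst x y.
move=> _ _; f_equal; exact: Prop_irrelevance.
Qed.

(** The induction step of Hessenberg's theorem, stated for a whole type so that it serves both the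
    segments and A itself. *)
Lemma square_step (A : Type) (lt : A -> A -> Prop) : WO lt -> le_card nat A ->
  (forall a, le_card nat {x | lt x a} ->
     le_card ({x | lt x a} * {x | lt x a}) {x | lt x a}) ->
  le_card (A * A) A.
Proof.
move=> h inf IH.
have [cA|ncA] := EM (le_card A nat).
  apply: le_card_trans (le_card_prod cA cA) _.
  exact: le_card_trans nat_prod_nat inf.
have [[a Aa]|init] := EM (exists a, le_card A {x | lt x a}).
  apply: le_card_trans (le_card_prod Aa Aa) _.
  apply: le_card_trans (IH a (le_card_trans inf Aa)) _.
  exact: le_card_sigT.
(* Goedel's well-ordering of pairs *)
pose code (u : A * A) := (wo_max lt u.1 u.2, u).
have hG := WO_pull (f := code) (fun x y e => f_equal snd e) (WO_lex h (WO_lex h h)).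
case: (wo_compare h hG) => [[f [fi fd]]|[a [g [gi _]]]]; last first.
  exists g; exact: (incr_inj hG (wo_irr h) gi).
have [onto|nonto] := EM (forall p, exists x, f x = p).
  have [g gP] := choice onto.
  by exists g => x y e; rewrite -(gP x) e gP.
have [p np] : exists p, forall x, f x <> p.
  apply: contrapT => n; apply: nonto => p; apply: contrapT => np.
  by apply: n; exists p => x fx; apply: np; exists x.
(* All values of f precede the missed pair p, so their coordinates are at most m, and A embeds into
   the square of the closed segment at m. *)
exfalso; pose m := wo_max lt p.1 p.2.
have bd x : (lt (f x).1 m \/ (f x).1 = m) /\ (lt (f x).2 m \/ (f x).2 = m).
  have fp : lex lt (lex lt lt) (code (f x)) (code p).
    case: (wo_tri hG (f x) p) => [//|[e|/fd [y e]]]; first by case: (np x).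
    by case: (np y).
  have mm : ~ lt m (wo_max lt (f x).1 (f x).2).
    case: fp => /= [fp|[-> _]]; [exact: (wo_asym h fp)|exact: (wo_irr h)].
  have le y : ~ lt (wo_max lt (f x).1 (f x).2) y -> lt y m \/ y = m.
    by move=> /(wo_le_trans h) /(_ mm) /(wo_nlt h) [->|]; auto.
  by split; apply: le; [exact: wo_max_l | exact: wo_max_r].
have le1 : le_card A ({x | lt x m \/ x = m} * {x | lt x m \/ x = m}).
  pose Q x := lt x m \/ x = m.
  exists (fun x => (exist Q _ (bd x).1, exist Q _ (bd x).2)) => x y [e1 e2].
  by apply: (incr_inj h (wo_irr hG) fi); case: (f x) (f y) e1 e2 => [? ?] [? ?] /= -> ->.
have le2 := le_card_seg_closed lt m.
have [infm|/nle_card fm] := EM (le_card nat {x | lt x m}).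
  apply: init; exists m.
  have le3 := le_card_trans le2 (hilbert_hotel infm).
  apply: le_card_trans le1 _.
  exact: le_card_trans (le_card_prod le3 le3) (IH m infm).
apply: ncA.
have le3 : le_card {x | lt x m \/ x = m} nat.
  apply: le_card_trans le2 _.
  apply: le_card_trans (hilbert_hotel (le_card_refl nat)).
  case: fm => g gi; exists (fun o => match o with Some u => Some (g u) | None => None end).
  by move=> [u|] [v|] // [/gi ->].
apply: le_card_trans le1 (le_card_trans (le_card_prod le3 le3) nat_prod_nat).
Qed.

Theorem Hessenberg (A : Type) : le_card nat A -> le_card (A * A) A.
Proof.
have [lt h] := zermelo A.
move=> inf; apply: (square_step h inf).
move=> a; elim/(well_founded_ind (wo_wf h)): a => a IH infa.
have ha := WO_sig (fun x => lt x a) h.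
apply: (square_step ha infa) => -[b ba] infb.
have le1 : le_card {x : {x | lt x a} | restr lt (fun x => lt x a) x (exist _ b ba)}
    {x | lt x b}.
  by apply: (@le_card_sig _ _ _ _ sval) => [|[x xa] [y ya] _ _ /= e] //;
     subst y; congr exist; exact: Prop_irrelevance.
have le2 : le_card {x | lt x b}
   {x : {x | lt x a} | restr lt (fun x => lt x a) x (exist _ b ba)}.
  have t x : lt x b -> lt x a by move=> xb; exact: (wo_trans h xb ba).
  exists (fun u => exist (fun x : {x | lt x a} => restr lt (fun x => lt x a) x (exist _ b ba))
     (exist _ (sval u) (t _ (proj2_sig u))) (proj2_sig u)).
  move=> [x xb] [y yb] [e]; subst y; congr exist; exact: Prop_irrelevance.
apply: le_card_trans (le_card_prod le1 le1) _.
exact: le_card_trans (IH b ba (le_card_trans infb le1)) le2.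
Qed.

Lemma le_card_list (A : Type) : le_card nat A -> le_card (list A) A.
Proof.
move=> inf; have [f fi] := Hessenberg inf; have [c ci] := inf.
pose g := fix g l := match l with [] => c 0 | x :: l => f (x, g l) end.
exists (fun l => f (c (length l), g l)).
elim=> [|x l IH] [|y k] //= /fi [/ci] // [e] /fi [-> e'].
by rewrite (IH k) // e' e.
Qed.

Lemma eq_card_ge (A B : Type) : eq_card A B -> le_card B A.
Proof.
move=> [f [_ fs]]; have [g gP] := choice fs.
by exists g => x y e; rewrite -(gP x) e gP.
Qed.

Lemma le_card_pow (A B : Type) : le_card A B -> le_card (A -> Prop) (B -> Prop).
Proof.
move=> [f fi]; exists (fun P b => exists a, P a /\ f a = b) => P Q e.
apply: funext => a; apply: propext.
have key (b : B) : (exists a, P a /\ f a = b) <-> (exists a, Q a /\ f a = b).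
  by have := f_equal (fun X => X b) e => /= ->.
split=> [Pa|Qa].
  by have [a' [Qa' /fi <-]] := (key (f a)).1 (ex_intro _ a (conj Pa erefl)).
by have [a' [Pa' /fi <-]] := (key (f a)).2 (ex_intro _ a (conj Qa erefl)).
Qed.

Lemma Cantor_diagonal (A : Type) : ~ le_card (A -> Prop) A.
Proof.
move=> [f fi]; pose D a := exists P, f P = a /\ ~ P a.
have [DD|n] := EM (D (f D)); last by apply: (n); exists D.
by case: (DD) => P [/fi e nP]; apply: nP; rewrite e.
Qed.

(** * Dense embeddings and collapsing algebras *)

#[local] Arguments compat {P} p q.
#[local] Arguments sep_le {P} p q.
#[local] Arguments sep_cls {P} p.
#[local] Arguments regular_open {P} U.

Lemma sig_eq (A : Type) (P : A -> Prop) (u v : {x | P x}) : sval u = sval v -> u = v.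
Proof.
case: u v => [x Px] [y Py] /= e; subst y; congr exist; exact: Prop_irrelevance.
Qed.

(** A regular open set is determined by its trace on a dense set. Reflection of compatibility along
    e makes the trace regular open in Q and makes [push] a right inverse of [pull]. *)
Lemma dense_embedding_cba_iso (P Q : Preord) (e : car Q -> car P) :
  (forall p, le P p p) -> (forall p q r, le P p q -> le P q r -> le P p r) ->
  (forall p, le Q p p) -> (forall p q r, le Q p q -> le Q q r -> le Q p r) ->
  (forall s t, le Q s t -> le P (e s) (e t)) ->
  (forall s t, compat (e s) (e t) -> compat s t) ->
  (forall p, exists s, le P (e s) p) ->
  cba_iso P Q.
Proof.
move=> rP tP rQ tQ mono cmp dense.
have down (R : Preord) (U : car R -> Prop) : (forall p, le R p p) ->
    (forall p q r, le R p q -> le R q r -> le R p r) ->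
    regular_open U -> forall p q, le R q p -> U p -> U q.
  move=> rR tR reg p q qp /(reg p) Up; apply/(reg q) => r rq.
  by apply: Up; exact: tR qp.
pose pull (U : car P -> Prop) s := U (e s).
have pull_reg U : regular_open U -> regular_open (pull U).
  move=> reg s; split=> [Us t ts|h].
    by exists t; split=> //; apply: (down _ _ rP tP reg _ _ (mono _ _ ts)).
  apply/(reg (e s)) => q qs; have [t tq] := dense q.
  have [|w [wt ws]] := cmp t s.
    by exists (e t); split=> //; exact: tP qs.
  have [r [rw Ur]] := h w ws; exists (e r); split=> //.
  exact: tP (mono _ _ (tQ _ _ _ rw wt)) tq.
pose push (V : car Q -> Prop) p := forall t, le P (e t) p -> V t.
have push_reg V : regular_open V -> regular_open (push V).
  move=> reg p; split=> [Up q qp|h].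
    by exists q; split=> // t tq; apply: Up; exact: tP qp.
  move=> t tp; apply/(reg t) => w wt.
  have [r [rw Ur]] := h (e w) (tP _ _ _ (mono _ _ wt) tp).
  have [z zr] := dense r.
  have [|y [yz yw]] := cmp z w; first by exists (e z); split=> //; exact: tP rw.
  by exists y; split=> //; apply: (down _ _ rQ tQ reg _ _ yz); exact: Ur.
exists (fun U => exist _ _ (pull_reg _ (proj2_sig U))).
have emb (U V : ro P) : (forall s, sval U (e s) -> sval V (e s)) -> ro_le U V.
  move=> h p Up; apply/(proj2_sig V p) => q qp; have [t tq] := dense q.
  exists (e t); split=> //; apply: h.
  exact: (down _ _ rP tP (proj2_sig U) _ _ (tP _ _ _ tq qp)).
split; [|split].
- move=> U V /(f_equal sval) /= uv; apply: sig_eq; apply: funext => p; apply: propext.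
  have uv' s : sval U (e s) = sval V (e s) by exact: (f_equal (fun X => X s) uv).
  by split; [apply: (emb U V) => s; rewrite uv' | apply: (emb V U) => s; rewrite uv'].
- move=> V; exists (exist _ _ (push_reg _ (proj2_sig V))); apply: sig_eq => /=.
  apply: funext => s; apply: propext; split=> [h|Vs t ts]; first by apply: h; exact: rP.
  apply/(proj2_sig V t) => w wt.
  have [|z [zw zs]] := cmp w s.
    by exists (e w); split=> //; exact: tP (mono _ _ wt) ts.
  by exists z; split=> //; apply: (down _ _ rQ tQ (proj2_sig V) _ _ zs).
- by move=> U V; split=> [uv s|h]; [exact: uv | exact: emb].
Qed.

Lemma initial_wo (Q : Type) :
  exists lt : Q -> Q -> Prop, WO lt /\ forall q, ~ le_card Q {y | lt y q}.
Proof.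
have [lt h] := zermelo Q.
have [[m0 Qm0]|n] := EM (exists m, le_card Q {y | lt y m}); last first.
  by exists lt; split=> // q Qq; apply: n; exists q.
have [m [[f fi] mm]] := wo_min h (ex_intro (fun m => le_card Q {y | lt y m}) _ Qm0).
have gi x y : sval (f x) = sval (f y) -> x = y by move=> /sig_eq; exact: fi.
exists (fun x y => lt (sval (f x)) (sval (f y))); split.
  exact: (WO_pull gi h).
move=> q Qq; apply: (mm (sval (f q))); last exact: (proj2_sig (f q)).
apply: le_card_trans Qq _.
by apply: (@le_card_sig _ _ _ _ (fun x => sval (f x))) => // x y _ _; exact: gi.
Qed.

(** Along an order of Q whose segments are all smaller than Q, the values used before stage q are
    too few to exhaust [S q]. *)
Lemma distinct_representatives (Q B Lam : Type) (S : Q -> B -> Prop) :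
  le_card Q Lam -> (forall q, le_card Lam {b | S q b}) ->
  exists t : Q -> B, (forall q q', t q = t q' -> q = q') /\ forall q, S q (t q).
Proof.
move=> QL SL; have [lt [h init]] := initial_wo Q.
have [[q0]|nQ] := EM (inhabited Q); last first.
  have F (q : Q) : False by apply: nQ.
  by exists (fun q => match F q with end); split=> q; case: (F q).
have [b0] : inhabited B.
  by have [f _] := SL q0; have [g _] := QL; case: (f (g q0)) => b _.
pose R q (g : Q -> B) b := S q b /\ forall y, lt y q -> g y <> b.
have [] := @wf_choice _ _ lt R (inhabits b0) (wo_wf h).
- move=> q g g' b gg' [Sb nb]; split=> // y yq; rewrite -gg' //; exact: nb.
- move=> q g _; apply: contrapT => n; apply: (init q).
  apply: le_card_trans QL (le_card_trans (SL q) _).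
  apply: (surj_on_le_card (f := g)) => b Sb; apply: contrapT => nb.
  by apply: n; exists b; split=> // y yq e; apply: nb; exists y.
move=> t tP; exists t; split=> [q q' e|q]; last by case: (tP q).
case: (wo_tri h q q') => [l|[//|l]].
  by have [_ /(_ _ l)] := tP q'.
by have [_ /(_ _ l)] := tP q; rewrite e.
Qed.

Definition antichain (P : Preord) (X : car P -> Prop) :=
  forall x y, X x -> X y -> compat x y -> x = y.

Lemma maximal_antichain (P : Preord) (D X0 : car P -> Prop) :
  antichain X0 -> (forall x, X0 x -> D x) -> (forall p, le P p p) ->
  exists X : car P -> Prop, antichain X /\ (forall x, X0 x -> X x) /\ (forall x, X x -> D x) /\
    forall d, D d -> exists x, X x /\ compat d x.
Proof.
move=> aX0 X0D rP.
pose ok (X : car P -> Prop) := antichain (fun x => X0 x \/ X x) /\ forall x, X x -> D x.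
have [F okF totF|X [okX mX]] := @classical_sets.Zorn_bigcup (car P) ok.
  split; last by move=> x [X FX]; exact: (okF X FX).2.
  move=> x y [hx|[X FX Xx]] [hy|[Y FY Yy]]; first exact: aX0.
  - by apply: (okF Y FY).1; [left | right].
  - by apply: (okF X FX).1; [right | left].
  - case: (totF X Y FX FY) => sub.
      by apply: (okF Y FY).1; right=> //; exact: sub.
    by apply: (okF X FX).1; right=> //; exact: sub.
exists (fun x => X0 x \/ X x); split; first exact: okX.1.
split; first by auto.
split; first by move=> x [/X0D|/okX.2].
move=> d Dd; apply: contrapT => n.
apply: (mX (fun x => X x \/ x = d)).
  split; first by left.
  by move=> sub; apply: n; exists d; split; [right; apply: sub; right | exists d].
split; last by move=> x [/okX.2|->].
have nd x : (X0 x \/ X x) -> ~ compat d x by move=> Xx c; apply: n; exists x.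
move=> x y hx hy c.
have cs : compat y x by case: c => r [? ?]; exists r.
have sp z : X0 z \/ X z \/ z = d -> (X0 z \/ X z) \/ z = d by tauto.
case: (sp x hx) (sp y hy) => [Xx|ex] [Xy|ey].
- exact: okX.1.
- by subst y; case: (nd x Xx cs).
- by subst x; case: (nd y Xy c).
- by rewrite ex ey.
Qed.

(** * A dense copy of the collapsing tree *)

Section Collapse.
Variables (P : Preord) (Lam C : Type) (top : car P) (code : nat -> car P -> C -> Prop).
Hypothesis rP : forall p, le P p p.
Hypothesis tP : forall p q r, le P p q -> le P q r -> le P p r.
Hypothesis topP : forall p, le P p top.
Hypothesis cardP : le_card (car P) Lam.
Hypothesis code_down : forall n p q c, le P q p -> code n p c -> code n q c.
Hypothesis code_unique : forall n p c c', code n p c -> code n p c' -> c = c'.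
Hypothesis code_rich :
  forall p, exists n, le_card Lam {c | exists q, le P q p /\ code n q c}.

(** A common lower bound inherits the codes of both conditions and has only one, so conditions with
    different codes are incompatible. *)
Lemma code_antichain p n : le_card Lam {c | exists q, le P q p /\ code n q c} ->
  exists (a : Lam -> car P) (c : Lam -> C), (forall x, le P (a x) p) /\
    (forall x, code n (a x) (c x)) /\ (forall x y, c x = c y -> x = y) /\
    forall x y, compat (a x) (a y) -> x = y.
Proof.
move=> [f fi]; have h x := proj2_sig (f x); have [a aP] := choice h.
have ci x y : sval (f x) = sval (f y) -> x = y by move=> /sig_eq; exact: fi.
exists a, (fun x => sval (f x)); split; [|split; [|split]] => //.
- by move=> x; exact: (aP x).1.
- by move=> x; exact: (aP x).2.
- move=> x y [r [rx ry]]; apply: ci; apply: (@code_unique n r).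
    exact: code_down rx (aP x).2.
  exact: code_down ry (aP y).2.
Qed.

(** An antichain of size [Lam] below an element of D under r0 is extended to a maximal one in D
    below p. Its size is exactly [Lam], as P has no more elements, and its starting part gives the
    member below r0. *)
Lemma split_below (D : car P -> Prop) (p r0 : car P) :
  (forall q, exists r, le P r q /\ D r) -> (forall q r, le P r q -> D q -> D r) ->
  le P r0 p ->
  exists c : Lam -> car P, (forall x, le P (c x) p) /\ (forall x, D (c x)) /\
    (forall x y, compat (c x) (c y) -> x = y) /\
    (forall q, le P q p -> exists x, compat q (c x)) /\
    (exists x, le P (c x) r0).
Proof.
move=> dense down r0p; have [r1 [r10 Dr1]] := dense r0.
have [n /code_antichain [a [_ [ap [_ [_ aa]]]]]] := code_rich r1.
pose D' q := D q /\ le P q p; pose X0 q := exists x, a x = q.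
have [X [aX [X0X [XD mX]]]] : exists X : car P -> Prop, antichain X /\
    (forall x, X0 x -> X x) /\ (forall x, X x -> D' x) /\
    forall d, D' d -> exists x, X x /\ compat d x.
  apply: maximal_antichain => //.
    by move=> _ _ [x <-] [y <-] /aa ->.
  by move=> _ [x <-]; split; [exact: down (ap x) Dr1 | exact: tP (ap x) (tP r10 r0p)].
have [f [fi fs]] : eq_card Lam {x | X x}.
  apply: Cantor_Bernstein; last exact: le_card_trans (le_card_sigT X) cardP.
  exists (fun x => exist X (a x) (X0X _ (ex_intro _ x erefl))) => x y [e].
  by apply: aa; rewrite e; exists (a y).
exists (fun x => sval (f x)); split; [|split; [|split; [|split]]].
- by move=> x; exact: (XD _ (proj2_sig (f x))).2.
- by move=> x; exact: (XD _ (proj2_sig (f x))).1.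
- move=> x y c; apply: fi; apply: sig_eq; apply: aX => //; exact: proj2_sig.
- move=> q qp; have [d [dq Dd]] := dense q.
  have [|x [Xx [r [rd rx]]]] := mX d; first by split=> //; exact: tP qp.
  have [y fy] := fs (exist X x Xx); exists y; rewrite fy.
  by exists r; split=> //; exact: tP dq.
- have [g _] := cardP; pose x0 := g top.
  have [y fy] := fs (exist X (a x0) (X0X _ (ex_intro _ x0 erefl))).
  by exists y; rewrite fy; exact: tP (ap x0) r10.
Qed.

(** Carrying a code need not be dense; carrying one or having no coded extension is. *)
Definition decides n r := (exists c, code n r c) \/ forall q c, le P q r -> ~ code n q c.

(** The last clause is the source of density. Every q that meets [Lam] many nodes of level n is
    given a node [t q] of its own, and the splitting of that node starts below a common extension
    with q. *)
Lemma next_level n (e : list Lam -> car P) :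
  exists e' : list Lam -> car P, forall s, length s = n ->
    (forall x, le P (e' (x :: s)) (e s)) /\ (forall x, decides n (e' (x :: s))) /\
    (forall x y, compat (e' (x :: s)) (e' (y :: s)) -> x = y) /\
    (forall q, le P q (e s) -> exists x, compat q (e' (x :: s))) /\
    (forall q, le_card Lam {t | length t = n /\ compat q (e t)} ->
       exists t x, length t = n /\ le P (e' (x :: t)) q).
Proof.
pose Q := {q | le_card Lam {t | length t = n /\ compat q (e t)}}.
have [t [ti tS]] := @distinct_representatives Q (list Lam) Lam
  (fun q t => length t = n /\ compat (sval q) (e t))
  (le_card_trans (le_card_sigT _) cardP) (fun q => proj2_sig q).
have dense q : exists r, le P r q /\ decides n r.
  have [[r [c [rq cr]]]|no] := EM (exists r c, le P r q /\ code n r c).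
    by exists r; split=> //; left; exists c.
  by exists q; split=> //; right=> r c rq cr; apply: no; exists r, c.
have down q r : le P r q -> decides n q -> decides n r.
  move=> rq [[c cq]|no]; first by left; exists c; exact: code_down cq.
  by right=> w c wr; apply: no; exact: tP rq.
have h s : exists c : Lam -> car P, (forall x, le P (c x) (e s)) /\ (forall x, decides n (c x)) /\
    (forall x y, compat (c x) (c y) -> x = y) /\
    (forall q, le P q (e s) -> exists x, compat q (c x)) /\
    (forall q, t q = s -> exists x, le P (c x) (sval q)).
  have [r0 [r0s r0q]] : exists r0, le P r0 (e s) /\ forall q, t q = s -> le P r0 (sval q).
    have [[q tq]|no] := EM (exists q, t q = s).
      have [_ [r [rq rt]]] := tS q; exists r; rewrite -tq; split=> // q' /ti ->; exact: rq.
    by exists (e s); split=> // q tq; case: no; exists q.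
  have [c [h1 [h2 [h3 [h4 [x h5]]]]]] := split_below dense down r0s.
  exists c; do 4![split=> //]; move=> q tq; exists x; exact: tP h5 (r0q _ tq).
have [c cP] := choice h.
exists (fun l => match l with [] => top | x :: s => c s x end) => s ls.
have [h1 [h2 [h3 [h4 _]]]] := cP s; do 4![split=> //].
move=> q hq; have [_ [_ [_ [_ h5]]]] := cP (t (exist _ q hq)).
have [x xq] := h5 _ erefl; exists (t (exist _ q hq)), x; split=> //.
exact: (tS (exist _ q hq)).1.
Qed.

(** Let q admit [Lam] codes at n. Nodes of level n+1 decide n, so a node compatible with a coded
    condition carries the same code, and different codes lead to different nodes. Thus q meets [Lam]
    nodes of level n+1, and some node of level n+2 lies below q. *)
Theorem Col_embeds_densely :
  exists e : list Lam -> car P, (forall s u, le P (e (s ++ u)) (e s)) /\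
    (forall s t, compat (e s) (e t) -> @compat (ColPoset Lam) s t) /\
    (forall p, exists s, le P (e s) p).
Proof.
have [F FP] := choice (fun ne : nat * (list Lam -> car P) => next_level ne.1 ne.2).
pose E := fix E n := match n with 0 => fun=> top | S n => F (n, E n) end.
have EP n := FP (n, E n).
(* Levels add the new label at the head, whereas conditions of [ColPoset] are extended at the
   end. *)
pose e s := E (length s) (rev s).
have mono1 s x : le P (e (s ++ [x])) (e s).
  rewrite /e length_app rev_app_distr /= Nat.add_comm /=.
  have [|h _] := EP (length s) (rev s); [exact: length_rev | exact: h].
have mono s u : le P (e (s ++ u)) (e s).
  elim: u s => [|x u IH] s; first by rewrite app_nil_r.
  have -> : s ++ x :: u = (s ++ [x]) ++ u by rewrite -app_assoc.
  exact: tP (IH _) (mono1 _ _).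
have anti n : forall s t, length s = n -> length t = n -> compat (E n s) (E n t) -> s = t.
  elim: n => [|n IH] [|x s] [|y t] //= [ls] [lt] [r [rs rt]].
  have [h1 [_ [h2 _]]] := EP n s ls; have [h1' _] := EP n t lt.
  have est : s = t.
    by apply: IH => //; exists r; split; [exact: tP rs (h1 x) | exact: tP rt (h1' y)].
  by subst t; rewrite (h2 x y) //; exists r.
have anti_le s t : length s <= length t -> compat (e s) (e t) -> exists u, t = s ++ u.
  move=> lst [r [rs rt]]; exists (skipn (length s) t).
  rewrite -{1}(firstn_skipn (length s) t); congr (_ ++ _).
  have lf : length (firstn (length s) t) = length s by rewrite length_firstn; lia.
  rewrite -(rev_involutive s) -(rev_involutive (firstn _ _)); congr rev.
  apply: (anti (length s)); rewrite ?length_rev //.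
  exists r; split=> //; rewrite -{1}lf.
  apply: (tP rt); rewrite -{1}(firstn_skipn (length s) t); exact: mono.
have maxi n : forall q, exists s, length s = n /\ compat q (E n s).
  elim: n => [|n IH] q; first by exists []; split=> //; exists q.
  have [s [ls [r [rq rs]]]] := IH q; have [_ [_ [_ [h _]]]] := EP n s ls.
  have [x [r' [r'r r'x]]] := h r rs.
  exists (x :: s); split; first by rewrite /= ls.
  by exists r'; split=> //; exact: tP rq.
exists e; split=> //; split.
  move=> s t c; have cs : compat (e t) (e s) by case: c => r [? ?]; exists r.
  case: (Nat.le_ge_cases (length s) (length t)) => l.
    by have [u ->] := anti_le _ _ l c; exists (s ++ u); split; [exists u | exists []; rewrite app_nil_r].
  by have [u ->] := anti_le _ _ l cs; exists (t ++ u); split; [exists []; rewrite app_nil_r | exists u].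
move=> q; have [n hn] := code_rich q.
have [a [c [aq [ac [ci _]]]]] := code_antichain hn.
have [s sP] := choice (fun x => maxi (S n) (a x)).
have [[|x0 t0] [lt0 _]] := maxi (S n) q; first by [].
have big : le_card Lam {t | length t = S n /\ compat q (E (S n) t)}.
  have hs x : length (s x) = S n /\ compat q (E (S n) (s x)).
    have [ls [r [ra rs]]] := sP x; split=> //; exists r; split=> //; exact: tP (aq x).
  pose T t := length t = S n /\ compat q (E (S n) t).
  exists (fun x => exist T (s x) (hs x)) => x y [exy].
  have hc z : code n (E (S n) (s z)) (c z).
    have [ls [r [ra rs]]] := sP z; case es: (s z) ls rs => [//|w t] [lt] rt.
    have [_ [h _]] := EP n t lt; case: (h w) => [[c' hc']|no].
      suff -> : c z = c' by [].
      apply: (@code_unique n r); first exact: code_down ra (ac z).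
      exact: code_down rt hc'.
    by case: (no r (c z) rt); exact: code_down ra (ac z).
  apply: ci; apply: (@code_unique n (E (S n) (s x))); first exact: hc.
  rewrite exy; exact: hc.
have [_ [_ [_ [_ h]]]] := EP (S n) (x0 :: t0) lt0.
have [t [x [lt tq]]] := h q big.
exists (rev (x :: t)); rewrite /e length_rev rev_involutive /= lt; exact: tq.
Qed.

Theorem sq_cba_iso_Col : cba_iso (sq P) (ColPoset Lam).
Proof.
have [e [mono [cmp dense]]] := Col_embeds_densely.
have sep_le_of p q : le P p q -> sep_le p q.
  by move=> pq r rp; exists r; split=> //; exact: tP pq.
have sep_trans p q r : @sep_le P p q -> sep_le q r -> sep_le p r.
  move=> pq qr x xp; have [y [yx yq]] := pq x xp.
  have [z [zy zr]] := qr y yq; exists z; split=> //; exact: tP yx.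
have clsE p q : sep_cls p = sep_cls q -> @sep_le P p q /\ sep_le q p.
  move=> h; have hq : sep_cls q q by split; apply: sep_le_of; exact: rP.
  by rewrite -h in hq.
pose cls p : car (sq P) := exist _ (sep_cls p) (ex_intro _ p erefl).
have leE p q : le (sq P) (cls p) (cls q) <-> sep_le p q.
  split=> [[p' [q' [/= /clsE [h1 _] [/clsE [_ h2] h]]]]|h]; last by exists p, q.
  exact: sep_trans h1 (sep_trans _ _ _ h h2).
have onto S : exists p, S = cls p.
  by case: S => S [p ep]; exists p; apply: sig_eq.
apply: (@dense_embedding_cba_iso (sq P) (ColPoset Lam) (fun s => cls (e s))).
- by move=> S; have [p ->] := onto S; apply/leE; exact: sep_le_of.
- move=> S T U; have [p ->] := onto S; have [q ->] := onto T; have [r ->] := onto U.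
  by move=> /leE pq /leE qr; apply/leE; exact: sep_trans qr.
- by move=> s; exists []; rewrite app_nil_r.
- by move=> s t r [u ->] [v ->]; exists (v ++ u); rewrite app_assoc.
- by move=> s t [u ->]; apply/leE; apply: sep_le_of; exact: mono.
- move=> s t [S []]; have [p ->] := onto S => /leE ps /leE pt; apply: cmp.
  have [q [qp qs]] := ps p (rP p); have [r [rq rt]] := pt q qp.
  by exists r; split=> //; exact: tP qs.
- move=> S; have [p ->] := onto S; have [s sp] := dense p; exists s; apply/leE.
  exact: sep_le_of.
Qed.

End Collapse.

(** * Regular well-orders and scales *)

Record regular (T : Type) (lt : T -> T -> Prop) : Prop := Regular {
  rg_wo : WO lt;
  rg_pt : inhabited T;
  rg_next : forall x, exists y, lt x y;
  rg_bound : forall a (f : T -> T), exists b, forall x, lt x a -> lt (f x) b }.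

Definition unbounded (T : Type) (lt : T -> T -> Prop) (X : T -> Prop) :=
  forall b, exists x, X x /\ lt b x.

Definition bounded (T : Type) (lt : T -> T -> Prop) (X : T -> Prop) :=
  exists b, forall x, X x -> lt x b.

(* Fewer than cf(T) elements, expressed without cardinals *)
Definition small (T : Type) (lt : T -> T -> Prop) (I : Type) (S : I -> Prop) :=
  forall f : I -> T, exists b, forall i, S i -> lt (f i) b.

Section Regular.
Variables (T : Type) (lt : T -> T -> Prop) (rT : regular lt).
Let hT := rg_wo rT.
Notation small := (small lt).
Notation unbounded := (unbounded lt).
Notation bounded := (bounded lt).

Lemma small_seg a : small (fun x => lt x a).
Proof. exact: (rg_bound rT). Qed.

Lemma small_image (I J : Type) (S : I -> Prop) (S' : J -> Prop) (f : I -> J) :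
  small S -> (forall j, S' j -> exists i, S i /\ f i = j) -> small S'.
Proof.
move=> sm h g; have [b bP] := sm (fun i => g (f i)).
by exists b => j /h [i [Si <-]]; exact: bP.
Qed.

Lemma small_sub (I : Type) (S S' : I -> Prop) :
  small S -> (forall i, S' i -> S i) -> small S'.
Proof. by move=> sm h f; have [b bP] := sm f; exists b => i /h; exact: bP. Qed.

Lemma small_bigcup (I J : Type) (S : I -> Prop) (L : I -> J -> Prop) :
  small S -> (forall i, S i -> small (L i)) -> small (fun j => exists i, S i /\ L i j).
Proof.
move=> sS sL f.
have [t0] := rg_pt rT.
have h i : exists b, S i -> forall j, L i j -> lt (f j) b.
  have [Si|nSi] := EM (S i); last by exists t0.
  by have [b bP] := sL i Si f; exists b.
have [g gP] := choice h; have [b bP] := sS g.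
exists b => j [i [Si Lij]]; exact: (wo_trans hT (gP i Si j Lij) (bP i Si)).
Qed.

Lemma small_bounded (I : Type) (S : I -> Prop) (X : I -> T -> Prop) :
  small S -> (forall i, S i -> bounded (X i)) ->
  bounded (fun x => exists i, S i /\ X i x).
Proof.
move=> sS sX; have [t0] := rg_pt rT.
have h i : exists b, S i -> forall x, X i x -> lt x b.
  have [Si|nSi] := EM (S i); last by exists t0.
  by have [b bP] := sX i Si; exists b.
have [g gP] := choice h; have [b bP] := sS g.
exists b => x [i [Si Xi]]; exact: (wo_trans hT (gP i Si x Xi) (bP i Si)).
Qed.

Lemma small_seg_le a : small (fun x => ~ lt a x).
Proof.
have [b ab] := rg_next rT a; apply: small_sub (small_seg b) _ => x ax.
exact: (wo_le_lt hT ax ab).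
Qed.

Lemma small_pt (I : Type) (i : I) : small (fun j => j = i).
Proof. by move=> f; have [b fb] := rg_next rT (f i); exists b => _ ->. Qed.

Lemma nbounded X : ~ bounded X <-> unbounded X.
Proof.
split=> [h b|u [b hb]]; last by have [x [/hb xb /(wo_trans hT xb) /(wo_irr hT)]] := u b.
have [c bc] := rg_next rT b; apply: contrapT => n; apply: h; exists c => x Xx.
have [|e] := EM (lt x c) => //; case: n; exists x; split=> //.
exact: (wo_lt_le hT bc e).
Qed.

Lemma nunbounded X : ~ unbounded X <-> bounded X.
Proof.
by split=> [n|b /nbounded u]; [apply: contrapT => /nbounded | apply: u].
Qed.

Lemma bounded_sub X Y : bounded X -> (forall x, Y x -> X x) -> bounded Y.
Proof. by move=> [b hb] YX; exists b => x /YX /hb. Qed.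

Lemma unbounded_sub (X Y : T -> Prop) : unbounded X -> (forall x, X x -> Y x) -> unbounded Y.
Proof. by move=> u XY b; have [x [/XY Yx bx]] := u b; exists x. Qed.

Lemma bounded_or X Y : bounded X -> bounded Y -> bounded (fun x => X x \/ Y x).
Proof.
move=> [a ha] [b hb]; exists (wo_max lt a b) => x [/ha xa|/hb xb].
  exact: (wo_lt_le hT xa (@wo_max_l _ _ hT _ _)).
exact: (wo_lt_le hT xb (@wo_max_r _ _ hT _ _)).
Qed.

Lemma unbounded_minus X Y : unbounded X -> bounded Y -> unbounded (fun x => X x /\ ~ Y x).
Proof.
move=> /nbounded uX bY; apply/nbounded => bXY; apply: uX.
apply: bounded_sub (bounded_or bXY bY) _ => x Xx.
by have [Yx|nYx] := EM (Y x); [right | left].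
Qed.

Lemma pigeonhole (I : Type) (S : I -> Prop) (X : T -> Prop) (Y : I -> T -> Prop) :
  small S -> unbounded X -> (forall x, X x -> exists i, S i /\ Y i x) ->
  exists i, S i /\ unbounded (fun x => X x /\ Y i x).
Proof.
move=> sS /nbounded uX XY; apply: contrapT => n; apply: uX.
apply: (bounded_sub (small_bounded (X := fun i x => X x /\ Y i x) sS _)).
  by move=> i Si; apply/nunbounded => u; apply: n; exists i.
by move=> x Xx; have [i [Si Yx]] := XY x Xx; exists i.
Qed.

Lemma succ_strict a b : exists c, lt a c /\ lt b c.
Proof.
have [c h] := rg_next rT (wo_max lt a b); exists c; split.
  exact: (wo_le_lt hT (@wo_max_l _ _ hT _ _) h).
exact: (wo_le_lt hT (@wo_max_r _ _ hT _ _) h).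
Qed.

Lemma enumerate (U : T -> Prop) : unbounded U ->
  exists u : T -> T, (forall x y, lt x y -> lt (u x) (u y)) /\ forall x, U (u x).
Proof.
move=> uU.
pose R x (f : T -> T) y := U y /\ forall z, lt z x -> lt (f z) y.
have [u uP] : exists u, forall x, R x u (u x).
  apply: (wf_choice (rg_pt rT) (wo_wf hT)) => [x f g y fg [Uy h]|x f _].
    by split=> // z zx; rewrite -fg //; exact: h.
  have [b hb] := rg_bound rT x f; have [y [Uy byy]] := uU b.
  by exists y; split=> // z /hb /(wo_trans hT); apply.
by exists u; split=> [x y xy|x]; [exact: (uP y).2 | exact: (uP x).1].
Qed.

Definition mono (F : T -> T) := forall x y, ~ lt y x -> ~ lt (F y) (F x).

(** Taking the least bound over all y up to x gives monotonicity, because a bound at a larger point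
    is also a bound at x. *)
Lemma mono_hull (I : Type) (S : I -> Prop) (F : I -> T -> T) : small S ->
  exists G, mono G /\ forall i x, S i -> lt (F i x) (G x).
Proof.
move=> sS.
have h x : exists b, (forall i y, S i -> ~ lt x y -> lt (F i y) b) /\
    forall b', (forall i y, S i -> ~ lt x y -> lt (F i y) b') -> ~ lt b' b.
  apply: (wo_min hT (P := fun b => forall i y, S i -> ~ lt x y -> lt (F i y) b)).
  have sS' : small (fun iy : I * T => exists i, S i /\ exists y, ~ lt x y /\ iy = (i, y)).
    apply: small_bigcup => // i Si; apply: (small_image (f := pair i) (small_seg_le x)).
    by move=> [i' y'] [y [xy [-> ->]]]; exists y.
  have [b hb] := sS' (fun iy => F iy.1 iy.2).
  by exists b => i y Si xy; apply: (hb (i, y)); exists i; split=> //; exists y.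
have [G GP] := choice h; exists G; split.
  move=> x y xy; apply: (GP x).2 => i z Si xz; apply: (GP y).1 => //.
  exact: (wo_le_trans hT xz xy).
by move=> i x Si; apply: (GP x).1 => //; exact: wo_irr.
Qed.

Definition dom (f g : T -> T) := exists c, forall x, lt c x -> ~ lt (g x) (f x).

Lemma dom_trans f g h : dom f g -> dom g h -> dom f h.
Proof.
move=> [a ha] [b hb]; have [c [ac bc]] := succ_strict a b.
exists c => x cx; apply: (wo_le_trans hT (ha x _) (hb x _)).
  exact: (wo_trans hT ac cx).
exact: (wo_trans hT bc cx).
Qed.

Lemma diagonal_bound (h : T -> T -> T) : exists G, forall k, dom (h k) G.
Proof.
have e x : exists b, forall k, lt k x -> lt (h k x) b by exact: (rg_bound rT x (fun k => h k x)).
have [G GP] := choice e; exists G => k; exists k => x kx.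
exact: (wo_asym hT (GP x k kx)).
Qed.

Lemma ndom f g : ~ dom f g -> unbounded (fun x => lt (g x) (f x)).
Proof.
move=> n b; apply: contrapT => h; apply: n; exists b => x bx gf.
by apply: h; exists x.
Qed.

End Regular.

(** * A scale of minimal length *)

Section Scale.
Variables (K : Type) (ltK : K -> K -> Prop) (rK : regular ltK).
Let hK := rg_wo rK.

(** The last clause expresses minimality: W is the first segment of a well-order of [K -> K] that
    indexes an unbounded family, or the whole order if no proper segment does. *)
Lemma shortest_unbounded_family :
  exists (W : Type) (ltW : W -> W -> Prop) (h : W -> K -> K), WO ltW /\
    (forall G, exists w, ~ dom ltK (h w) G) /\
    forall w (h' : W -> K -> K), exists G, forall x, ltW x w -> dom ltK (h' x) G.
Proof.
have [lt hlt] := zermelo (K -> K).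
have all : forall G, exists f, ~ dom ltK f G.
  move=> G; have [s sP] := choice (rg_next rK).
  exists (fun x => s (G x)) => -[c h]; have [x cx] := rg_next rK c; exact: (h x cx).
have [ex|n] := EM (exists (w : K -> K) (h : (K -> K) -> K -> K),
    forall G, exists x, lt x w /\ ~ dom ltK (h x) G); last first.
  exists (K -> K), lt, id; split=> //; split=> // w h'; apply: contrapT => nG.
  apply: n; exists w, h' => G; apply: contrapT => nx; apply: nG; exists G => x xw.
  by apply: contrapT => nd; apply: nx; exists x.
have [w [[h hP] wm]] := wo_min hlt ex.
pose W := {x | lt x w}; exists W, (restr lt _), (fun u => h (sval u)).
split; first exact: WO_sig.
split=> [G|v h'].
  by have [x [xw nd]] := hP G; exists (exist _ x xw).
apply: contrapT => nG; apply: (wm (sval v)); last exact: (proj2_sig v).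
exists (fun x => match pselect (lt x w) with left p => h' (exist _ x p) | right _ => id end) => G.
apply: contrapT => nx; apply: nG; exists G => x xv; apply: contrapT => nd; apply: nx.
exists (sval x); split; first exact: xv.
case: pselect => [p|np]; last by case: np; exact: (proj2_sig x).
by have -> : exist _ (sval x) p = x by exact: sig_eq.
Qed.

(** Unboundedness relative to V costs nothing for monotone functions: if M x bounds h at the next
    element of V after x, and [g w] exceeds M at x, then [g w] exceeds h at that next element. *)
Theorem scale_exists :
  exists (W : Type) (ltW : W -> W -> Prop) (g : W -> K -> K),
    regular ltW /\ (forall f : K -> W, exists b, forall k, ltW (f k) b) /\
    (forall w, mono ltK (g w)) /\ (forall u w, ltW u w -> dom ltK (g u) (g w)) /\
    forall h (V : K -> Prop), unbounded ltK V ->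
      exists w, unbounded ltK (fun v => V v /\ ltK (h v) (g w v)).
Proof.
have [W [ltW [h [hW [unb short]]]]] := shortest_unbounded_family.
have [k0] := rg_pt rK.
pose R w (f : W -> K -> K) b := mono ltK b /\ dom ltK (h w) b /\ forall x, ltW x w -> dom ltK (f x) b.
have [g gP] : exists g, forall w, R w g (g w).
  apply: (wf_choice _ (wo_wf hW)) => [|w f f' b ff' [mb [db hb]]|w f _]; first exact: (inhabits id).
    by do 2![split=> //] => x xw; rewrite -ff' //; exact: hb.
  have [G hG] := short w f.
  have s2 : small ltK (fun b : bool => True).
    move=> F; have [c [c1 c2]] := succ_strict rK (F true) (F false).
    by exists c => -[] _.
  have [b [mb hb]] := mono_hull rK (fun (b : bool) => if b then G else h w) s2.
  exists b; split=> //; split.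
    by exists k0 => x _; exact: (wo_asym hK (hb false x I)).
  move=> x /hG d; apply: (dom_trans rK d).
  by exists k0 => y _; exact: (wo_asym hK (hb true y I)).
(* If G dominates all the functions in question, any w with [h w] not dominated by G bounds their
   indices; every bounding property of W is an instance. *)
have unbg (J : Type) (S : J -> Prop) (f : J -> W) : (exists G, forall j, S j -> dom ltK (g (f j)) G) ->
    exists b, forall j, S j -> ltW (f j) b.
  move=> [G hG]; have [w nd] := unb G.
  exists w => j Sj; case: (wo_tri hW (f j) w) => [//|c]; case: nd.
  apply: (dom_trans rK (gP w).2.1); apply: (dom_trans rK _ (hG _ Sj)).
  case: c => [->|wl]; last exact: (gP (f j)).2.2.
  by exists k0 => x _; exact: (wo_irr hK).
exists W, ltW, g; split.
  split=> //.
  - by have [w _] := unb id; exists.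
  - move=> x; have [|b hb] := unbg unit (fun=> True) (fun=> x); last by exists b; exact: (hb tt).
    by exists (g x) => _ _; exists k0 => y _; exact: (wo_irr hK).
  - by move=> a f; apply: unbg; apply: (short a (fun x => g (f x))).
split.
  move=> f; have [|b hb] := unbg K (fun=> True) f; last by exists b => k; exact: hb.
  by have [G hG] := diagonal_bound rK (fun k => g (f k)); exists G => k _; exact: hG.
split; first by move=> w; exact: (gP w).1.
split; first by move=> u w uw; exact: (gP w).2.2.
move=> f V uV.
have e x : exists v, V v /\ ltK x v /\ forall v', V v' /\ ltK x v' -> ~ ltK v' v.
  have [v [[Vv xv] mv]] := wo_min hK (uV x); by exists v.
have [nx nxP] := choice e.
have s1 : small ltK (fun _ : unit => True) by move=> F; have [c hc] := rg_next rK (F tt); exists c => -[].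
have [M [mM hM]] := mono_hull rK (fun (_ : unit) x => f (nx x)) s1.
have [w nd] := unb M.
have {}nd : ~ dom ltK (g w) M by move=> d; apply: nd; exact: (dom_trans rK (gP w).2.1 d).
exists w => b; have [x [Mx bx]] := ndom nd b.
have [Vv [xv mv]] := nxP x; exists (nx x); split; last exact: (wo_trans hK bx xv).
split=> //; apply: (wo_lt_le hK (wo_trans hK (hM tt x I) Mx)).
exact: ((gP w).1 _ _ (wo_asym hK xv)).
Qed.

End Scale.

(** * Descending sequences of regressive functions *)

Definition ladder (K W : Type) (ltK : K -> K -> Prop) (ltW : W -> W -> Prop)
    (d : W) (l : K -> W) :=
  (forall i j, ltK i j -> ltW (l i) (l j)) /\ (forall i, ltW (l i) d) /\
  forall u, ltW u d -> exists i, ~ ltW (l i) u.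

Section Descent.
Variables (K : Type) (ltK : K -> K -> Prop) (rK : regular ltK).
Hypothesis unc : small ltK (fun _ : nat => True).
Variables (W : Type) (ltW : W -> W -> Prop) (rW : regular ltW).
Hypothesis KW : forall f : K -> W, exists b, forall k, ltW (f k) b.
Variable g : W -> K -> K.
Hypothesis g_mono : forall w, mono ltK (g w).
Hypothesis g_dom : forall u w, ltW u w -> dom ltK (g u) (g w).
Hypothesis g_unb : forall h (V : K -> Prop), unbounded ltK V ->
      exists w, unbounded ltK (fun v => V v /\ ltK (h v) (g w v)).
Let hK := rg_wo rK.
Let hW := rg_wo rW.
Notation unbounded := (unbounded ltK).
Notation bounded := (bounded ltK).
Notation small := (small ltK).

(* x is not closed under g w. *)
Definition jump w x := exists b, ltK b x /\ ~ ltK (g w b) x.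

Definition is_drop w x b := jump w x ->
  ltK b x /\ ~ ltK (g w b) x /\ forall b', ~ ltK (g w b') x -> ~ ltK b' b.

Lemma drop_ex w x : exists b, is_drop w x b.
Proof.
have [[b0 [b0x gb0]]|n] := EM (jump w x); last by exists x.
have [b [gb mb]] := wo_min hK (ex_intro (fun b => ~ ltK (g w b) x) b0 gb0).
exists b => _; split=> //; exact: (wo_le_lt hK (mb _ gb0) b0x).
Qed.

Definition drop w x := sval (cid (drop_ex w x)).

Lemma dropP w x : is_drop w x (drop w x).
Proof. exact: (svalP (cid (drop_ex w x))). Qed.

(** Beyond the point where [g w] takes over, a witness for u is one for w; the remaining witnesses
    only serve points up to a fixed value of [g u]. *)
Lemma jump_mono u w : ltW u w -> bounded (fun x => jump u x /\ ~ jump w x).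
Proof.
move=> uw; have [c hc] := g_dom uw; have [b gb] := rg_next rK (g u c).
exists b => x [[y [yx gy]] nj].
have [cy|yc] := EM (ltK c y).
  case: nj; exists y; split=> //; exact: (wo_le_trans hK gy (hc y cy)).
apply: (wo_le_lt hK _ gb) => gx; exact: (g_mono yc (wo_lt_le hK gx gy)).
Qed.

Fixpoint descend (s : list W) x := match s with
  | [] => x | z :: s => drop z (descend s x) end.

(* The label z of a step is the first index at which the current value jumps, modulo bounded sets. *)
Fixpoint typ (s : list W) (Y : K -> Prop) : Prop := match s with
  | [] => True
  | z :: s => typ s Y /\ (forall x, Y x -> jump z (descend s x)) /\
      forall u, ltW u z -> bounded (fun x => Y x /\ jump u (descend s x))
  end.

Lemma typ_sub s (Y Z : K -> Prop) : (forall x, Z x -> Y x) -> typ s Y -> typ s Z.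
Proof.
move=> ZY; elim: s => //= z s IH [/IH tZ [h1 h2]]; split=> //; split=> [x /ZY /h1|u /h2] //.
by move=> b; apply: (bounded_sub b) => x [/ZY].
Qed.

(** Lists grow at the head, so the tails are the earlier steps. At the first difference every point
    of one set jumps at the smaller label, but only boundedly many points of the other do. *)
Lemma typ_disjoint s s' (Y Y' : K -> Prop) : length s = length s' -> s <> s' ->
  typ s Y -> typ s' Y' -> bounded (fun x => Y x /\ Y' x).
Proof.
elim: s s' => [|z s IH] [|z' s'] //= [l] n [tY [Y1 Y2]] [tY' [Y1' Y2']].
have [e|ns] := EM (s = s'); last exact: IH l ns tY tY'.
subst s'; case: (wo_tri hW z z') => [h|[e|h]]; last 2 first.
- by case: n; rewrite e.
- by apply: (bounded_sub (Y2 _ h)) => x [? /Y1'].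
- by apply: (bounded_sub (Y2' _ h)) => x [/Y1].
Qed.

(** If x drops below b at z, then x is at most [g z b]. So [descend s] tends to infinity along Y. *)
Lemma typ_pull s (Y Z : K -> Prop) : typ s Y -> bounded Z ->
  bounded (fun x => Y x /\ Z (descend s x)).
Proof.
elim: s Z => /= [|z s IH] Z; first by move=> _ bZ; apply: (bounded_sub bZ) => x [].
move=> [tY [Y1 _]] [b hb]; have [c gc] := rg_next rK (g z b).
apply: (bounded_sub (IH (fun y => ltK y c) tY _)); first by exists c.
move=> x [Yx Zx]; split=> //; have [_ [h _]] := dropP (Y1 _ Yx).
apply: (wo_le_lt hK _ gc) => gb; apply: (g_mono (wo_asym hK (hb _ Zx))).
exact: (wo_lt_le hK gb h).
Qed.

(** Let h send b to an element of I above b. Wherever h b lies below [g w b], the point h b jumps at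
    w, with witness b. *)
Lemma jump_ex (I : K -> Prop) : unbounded I -> exists w, unbounded (fun x => I x /\ jump w x).
Proof.
move=> uI; have [h hP] := choice uI.
have [|w uw] := @g_unb h (fun=> True).
  by move=> b; have [c bc] := rg_next rK b; exists c.
exists w => b; have [x [[_ hx] bx]] := uw b; have [Ih xh] := hP x.
exists (h x); split; last exact: (wo_trans hK bx xh).
by split=> //; exists x; split=> //; exact: (wo_asym hK).
Qed.

Definition label (X : K -> Prop) s z :=
  exists Y : K -> Prop, (forall x, Y x -> X x) /\ unbounded Y /\ typ (z :: s) Y.

Lemma label_ex s X : typ s X -> unbounded X -> exists z, label X s z.
Proof.
move=> tX uX.
have [|w uw] := @jump_ex (fun y => exists x, X x /\ descend s x = y).
  apply/(nbounded rK) => bI; move/(nbounded rK): uX; apply.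
  by apply: (bounded_sub (typ_pull tX bI)) => x Xx; split=> //; exists x.
have ex : exists w, unbounded (fun x => X x /\ jump w (descend s x)).
  exists w; apply/(nbounded rK) => -[b hb].
  have [c hc] := rg_bound rK b (descend s).
  have [_ [[[x [Xx <-]] j] cx]] := uw c.
  by apply: (wo_asym hK cx); apply: hc; exact: hb.
have [z [uz mz]] := wo_min hW ex.
exists z, (fun x => X x /\ jump z (descend s x)); split; first by move=> x [].
split=> //=; split; first by apply: typ_sub tX => x [].
split; first by move=> x [].
move=> u uz'; apply/(nunbounded rK) => uu; apply: (mz u) => //.
by apply: (unbounded_sub uu) => x [[]].
Qed.

(* The points whose labels are s exactly, not only modulo a bounded set *)
Fixpoint trace (X : K -> Prop) s : K -> Prop := match s with
  | [] => X
  | z :: s => fun x => trace X s x /\ jump z (descend s x) /\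
      forall u, label (trace X s) s u -> ltW u z -> ~ jump u (descend s x)
  end.

Fixpoint traced (X : K -> Prop) s : Prop := match s with
  | [] => True | z :: s => traced X s /\ label (trace X s) s z end.

(* Otherwise almost every point of X would follow an infinite descending sequence. *)
Lemma many_labels X : unbounded X -> exists s X',
  (forall x, X' x -> X x) /\ typ s X' /\ ~ small (label X' s).
Proof.
move=> uX; apply: contrapT => H.
have {}H s X' : (forall x, X' x -> X x) -> typ s X' -> small (label X' s).
  by move=> sub t; apply: contrapT => n; apply: H; exists s, X'.
have sub s x : trace X s x -> X x by elim: s => //= z s IH [/IH].
have tt s : typ s (trace X s).
  elim: s => //= z s IH; split; first by apply: typ_sub IH => x [].
  split; first by move=> x [_ []].
  (* The least u < z at which unboundedly many points jump would itself be a label, and [trace]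
     forbids jumps at smaller labels. *)
  apply: contrapT => n.
  have [|u [[uz nb] mu]] := wo_min hW (P := fun u => ltW u z /\
      ~ bounded (fun x => trace X (z :: s) x /\ jump u (descend s x))).
    apply: contrapT => n'; apply: n => u uz; apply: contrapT => nb.
    by apply: n'; exists u.
  have lu : label (trace X s) s u.
    exists (fun x => trace X (z :: s) x /\ jump u (descend s x)).
    split; first by move=> x [[]].
    split; first exact/(nbounded rK).
    split; first by apply: typ_sub IH => x [[]].
    split; first by move=> x [].
    move=> v vu; apply: contrapT => nv; apply: (mu v) => //; split.
      exact: (wo_trans hW vu uz).
    by move=> b; apply: nv; apply: (bounded_sub b) => x [[]].
  have [k0] := rg_pt rK; apply: nb; exists k0 => x [[_ [_ h]] j].
  by case: (h u lu uz j).
have sl n : small (fun s => traced X s /\ length s = n).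
  elim: n => [|n IH].
    by apply: small_sub (small_pt rK []) _ => -[|z s] [].
  apply: small_sub (small_bigcup rK
     (L := fun s t => exists z, label (trace X s) s z /\ z :: s = t) IH _) _.
    move=> s _; apply: small_image (H s _ (sub s) (tt s)) _ => t [z [lz <-]].
    by exists z.
  move=> [|z s] /= [h1 h2] //; case: h1 h2 => ts lz [l].
  by exists s; split=> //; exists z.
have st : small (traced X).
  apply: small_sub (small_bigcup rK (L := fun n s => traced X s /\ length s = n) unc _) _.
    by move=> n _; exact: sl.
  by move=> s ts; exists (length s).
(* By [label_ex], an unbounded set of points that jump at no label would produce a further label. *)
have bad s : traced X s -> bounded (fun x => trace X s x /\
    forall z, label (trace X s) s z -> ~ jump z (descend s x)).
  move=> _; apply/(nunbounded rK) => uZ.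
  have tZ : typ s (fun x => trace X s x /\
      forall z, label (trace X s) s z -> ~ jump z (descend s x)).
    by apply: typ_sub (tt s) => x [].
  have [z [Y [YZ [uY tY]]]] := label_ex tZ uZ.
  have lz : label (trace X s) s z by exists Y; split=> // x /YZ [].
  have [k0] := rg_pt rK; have [x [Yx _]] := uY k0.
  have [_ h] := YZ x Yx; apply: (h z lz); exact: tY.2.1.
have [k0] := rg_pt rK.
have [x [[Xx nx] _]] := unbounded_minus rK uX (small_bounded rK st bad) k0.
(* The point x lies in none of the exceptional sets, so from every stage it can drop once more,
   always at its least label. *)
suff h y : forall s, traced X s -> trace X s x -> descend s x = y -> False.
  exact: (h x []).
elim/(well_founded_ind (wo_wf hK)): y => y IH s ts tx e.
have [|z [[lz jz] mz]] := wo_min hW (P := fun z => label (trace X s) s z /\ jump z (descend s x)).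
  apply: contrapT => n; apply: nx; exists s; split=> //; split=> // z lz j.
  by apply: n; exists z.
apply: (IH (descend (z :: s) x) _ (z :: s)) => //=.
  by rewrite -e; exact: (dropP jz).1.
split=> //; split=> // u lu uz j; exact: (mz u).
Qed.

Variable lad : W -> K -> W.
Hypothesis lad_ok : forall d, (exists l, ladder ltK ltW d l) -> ladder ltK ltW d (lad d).

Definition is_rank d y i := (exists j, jump (lad d j) y) ->
  jump (lad d i) y /\ forall j, jump (lad d j) y -> ~ ltK j i.

Lemma rank_ex d y : exists i, is_rank d y i.
Proof.
have [ex|n] := EM (exists j, jump (lad d j) y).
  by have [i hi] := wo_min hK ex; exists i.
by have [k0] := rg_pt rK; exists k0.
Qed.

Definition rank d y := sval (cid (rank_ex d y)).

Lemma rankP d y : is_rank d y (rank d y).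
Proof. exact: (svalP (cid (rank_ex d y))). Qed.

(** If f is unbounded on L, the values [l k] are chosen with f (l k) at least k, so f is unbounded
    on every set that contains them. *)
Lemma nsmall_cofinal (L : W -> Prop) : ~ small L -> exists l : K -> W,
  (forall k, L (l k)) /\ forall L' : W -> Prop, (forall k, L' (l k)) -> ~ small L'.
Proof.
move=> nL; have [f hf] : exists f : W -> K, ~ exists b, forall i, L i -> ltK (f i) b.
  by apply: contrapT => n; apply: nL => f; apply: contrapT => nf; apply: n; exists f.
have h k : exists z, L z /\ ~ ltK (f z) k.
  apply: contrapT => n; apply: hf; exists k => z Lz; apply: contrapT => fz.
  by apply: n; exists z.
have [l lP] := choice h; exists l; split=> [k|L' lL' /(_ f) [b hb]].
  exact: (lP k).1.
by apply: (lP b).2; exact: hb.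
Qed.

(* The least d with non-small many labels below it has cofinality K. *)
Lemma label_limit (L : W -> Prop) : ~ small L -> exists d, ladder ltK ltW d (lad d) /\
  forall u, ltW u d -> exists z, L z /\ ltW u z /\ ltW z d.
Proof.
move=> nL; have [l0 [Ll0 ns0]] := nsmall_cofinal nL; have [d0 ld0] := KW l0.
have [|d [nd md]] := wo_min hW (P := fun d => ~ small (fun z => L z /\ ltW z d)).
  by exists d0; apply: ns0 => k; split.
have sm u : ltW u d -> small (fun z => L z /\ ltW z u).
  by move=> ud; apply: contrapT => n; exact: (md u).
have sm' u : ltW u d -> small (fun z => L z /\ ~ ltW u z).
  move=> ud f; have [b hb] := sm u ud f; have [c [bc fc]] := succ_strict rK b (f u).
  exists c => z [Lz /(wo_nlt hW) [<- //|zu]].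
  exact: (wo_trans hK (hb z (conj Lz zu)) bc).
(* Otherwise the labels under d would be covered by few sets of labels up to some f i < d, each of
   them small by minimality of d. *)
have above (I : Type) (S : I -> Prop) (f : I -> W) : small S -> (forall i, S i -> ltW (f i) d) ->
    exists z, L z /\ ltW z d /\ forall i, S i -> ltW (f i) z.
  move=> sS fd; apply: contrapT => n; apply: nd.
  apply: small_sub (small_bigcup rK sS (L := fun i z => L z /\ ~ ltW (f i) z) _) _.
    by move=> i /fd; exact: sm'.
  move=> z [Lz zd]; apply: contrapT => n'; apply: n; exists z; split=> //; split=> // i Si.
  by apply: contrapT => nf; apply: n'; exists i.
exists d; split; last first.
  move=> u ud; have [z [Lz [zd uz]]] := above _ (fun v => v = u) id (small_pt rK u) (fun v e => ltac:(by rewrite e)).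
  by exists z; split=> //; split=> //; exact: uz.
apply: lad_ok; have [l [Ll ns]] := nsmall_cofinal nd.
pose R a (f : K -> W) z := ltW z d /\ forall b, ltK b a -> ltW (f b) z /\ ltW (l b) z.
have [f fP] : exists f, forall a, R a f (f a).
  apply: (wf_choice (rg_pt rW) (wo_wf hK)) => [a f h z fh [zd fz]|a f IH].
    by split=> // b ba; rewrite -fh //; exact: fz.
  have [z1 [_ [z1d fz1]]] := above _ _ f (small_seg rK a) (fun b ba => (IH b ba).1).
  have [z2 [_ [z2d lz2]]] := above _ _ l (small_seg rK a) (fun b ba => (Ll b).2).
  exists (wo_max ltW z1 z2); split; first exact: wo_max_lt.
  move=> b ba; split.
    exact: (wo_lt_le hW (fz1 b ba) (@wo_max_l _ _ hW _ _)).
  exact: (wo_lt_le hW (lz2 b ba) (@wo_max_r _ _ hW _ _)).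
exists f; split; first by move=> i j ij; exact: ((fP j).2 i ij).1.
split; first by move=> i; exact: (fP i).1.
move=> u ud; apply: contrapT => n.
apply: (ns (fun z => L z /\ ltW z u)) (sm u ud) => k; split; first exact: (Ll k).1.
have [k' kk'] := rg_next rK k.
apply: (wo_trans hW ((fP k').2 k kk').2); apply: contrapT => h; apply: n; by exists k'.
Qed.

(** Given v, take a label z between [lad d v] and d, and its set Y. Almost no point of Y jumps at
    [lad d i] for i up to v, but almost all jump at some [lad d i0] with index at least z. So the
    ranks lie above v and up to i0, and one rank has an unbounded fibre. *)
Theorem good_slot X : unbounded X -> exists s d X', (forall x, X' x -> X x) /\ typ s X' /\
  ladder ltK ltW d (lad d) /\
  unbounded (fun v => unbounded (fun x => X' x /\ jump d (descend s x) /\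
     (exists i, jump (lad d i) (descend s x)) /\ rank d (descend s x) = v)).
Proof.
move=> uX; have [s [X' [sub [t nL]]]] := many_labels uX.
have [d [ld labs]] := label_limit nL; exists s, d, X'; do 3![split=> //] => v.
have [linc [ldd lcof]] := ld.
have [z [[Y [YX [uY tY]]] [vz zd]]] := labs _ (ldd v).
have [i0 zi0] := lcof z zd.
have [tsY [Yz Y2]] := tY.
pose bad1 x := exists i, ~ ltK v i /\ (Y x /\ jump (lad d i) (descend s x)).
have b1 : bounded bad1.
  apply: (small_bounded rK (small_seg_le rK v)) => i /(wo_nlt hK) iv; apply: Y2.
  by case: iv => [<- //|/linc h]; exact: (wo_trans hW h vz).
have up w : ~ ltW w z -> bounded (fun x => Y x /\ jump z (descend s x) /\ ~ jump w (descend s x)).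
  move=> /(wo_nlt hW) [<-|/jump_mono h]; last exact: typ_pull tsY h.
  by have [k0] := rg_pt rK; exists k0 => x [_ []].
have u1 := unbounded_minus rK (unbounded_minus rK (unbounded_minus rK uY b1) (up _ zi0))
   (up _ (wo_asym hW zd)).
have [|i [_ ui]] := pigeonhole rK (Y := fun i x => rank d (descend s x) = i) (small_seg_le rK i0) u1.
  move=> x [[[Yx n1] n2] n3]; exists (rank d (descend s x)); split=> //.
  have j0 : jump (lad d i0) (descend s x).
    by apply: contrapT => nj; apply: n2; split=> //; split=> //; exact: Yz.
  exact: (rankP (ex_intro _ i0 j0)).2.
exists i; split.
  apply: (unbounded_sub ui) => x [[[[Yx n1] n2] n3] e]; split; first exact: YX.
  split.
    by apply: contrapT => nj; apply: n3; split=> //; split=> //; exact: Yz.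
  split=> //; exists i0; apply: contrapT => nj; apply: n2; split=> //; split=> //; exact: Yz.
have [k0] := rg_pt rK; have [x [[[[[Yx n1] n2] n3] e] _]] := ui k0.
have j0 : exists i, jump (lad d i) (descend s x).
  exists i0; apply: contrapT => nj; apply: n2; split=> //; split=> //; exact: Yz.
apply: contrapT => nvi; apply: n1; exists i; split=> //; split=> //.
by rewrite -e; exact: (rankP j0).1.
Qed.

(** Each u < d is at most some [lad d i], so up to a bounded set a jump at u forces a rank of at
    most i. Ranks tending to infinity therefore make d the first label. *)
Lemma rank_type s d Y : ladder ltK ltW d (lad d) -> typ s Y ->
  (forall x, Y x -> jump d (descend s x)) ->
  (forall b, bounded (fun x => Y x /\ ~ ltK b (rank d (descend s x)))) ->
  typ (d :: s) Y.
Proof.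
move=> [linc [ldd lcof]] t Yd Yr; split=> //; split=> // u ud.
have [i ui] := lcof u ud.
have b1 : bounded (fun x => Y x /\ jump u (descend s x) /\ ~ jump (lad d i) (descend s x)).
  case: (wo_nlt hW ui) => [<-|/jump_mono h]; last exact: typ_pull t h.
  by have [k0] := rg_pt rK; exists k0 => x [_ []].
apply: bounded_sub (bounded_or rK b1 (Yr i)) _ => x [Yx j].
have [ji|nj] := EM (jump (lad d i) (descend s x)); last by left.
right; split=> //; exact: (rankP (ex_intro _ i ji)).2.
Qed.

End Descent.

(** * Limits of cofinality K *)

Lemma small_le_card (K W : Type) (ltW : W -> W -> Prop) (I : Type) (S : I -> Prop) :
  (forall f : K -> W, exists b, forall k, ltW (f k) b) -> inhabited W ->
  le_card {i | S i} K -> small ltW S.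
Proof.
move=> KW [w0] [h hi] f.
have e k : exists w, forall i (Si : S i), h (exist _ i Si) = k -> w = f i.
  have [[u hu]|n] := EM (exists u, h u = k); last first.
    by exists w0 => i Si e; case: n; exists (exist _ i Si).
  exists (f (sval u)) => i Si; rewrite -hu => /hi e; by rewrite -e.
have [f' f'P] := choice e; have [b hb] := KW f'.
exists b => i Si; rewrite -(f'P _ i Si erefl); exact: hb.
Qed.

Section Limits.
Variables (K : Type) (ltK : K -> K -> Prop) (rK : regular ltK).
Variables (W : Type) (ltW : W -> W -> Prop) (rW : regular ltW).
Hypothesis KW : forall f : K -> W, exists b, forall k, ltW (f k) b.
Let hK := rg_wo rK.
Let hW := rg_wo rW.

Lemma all_small : small ltW (fun _ : K => True).
Proof. by move=> f; have [b hb] := KW f; exists b => k _. Qed.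

(** These sets of points play the part of closed unbounded sets restricted to cofinality K; a set
    that meets all of them is stationary. *)
Definition kclosed (F : W -> W) l :=
  (exists r, ladder ltK ltW l r) /\ forall b, ltW b l -> ltW (F b) l.

Lemma mono_above (F : W -> W) : exists G, mono ltW G /\ forall x, ltW (F x) (G x).
Proof.
have s1 : small ltW (fun _ : unit => True).
  by move=> f; have [c hc] := rg_next rW (f tt); exists c => -[].
by have [G [mG hG]] := mono_hull rW (fun (_ : unit) x => F x) s1; exists G; split=> // x; apply: (hG tt).
Qed.

Lemma kclosed_ex (F : W -> W) b0 : exists l, ltW b0 l /\ kclosed F l.
Proof.
have [G [mG FG]] := mono_above F.
pose R a (f : K -> W) z := ltW b0 z /\ forall b, ltK b a -> ltW (f b) z /\ ltW (G (f b)) z.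
have [c cP] : exists c, forall a, R a c (c a).
  apply: (wf_choice (rg_pt rW) (wo_wf hK)) => [a f f' z ff' [b0z h]|a f _].
    by split=> // b ba; rewrite -ff' //; exact: h.
  have [z1 h1] := KW f; have [z2 h2] := KW (fun b => G (f b)).
  have [z [z1z z2z]] := succ_strict rW z1 z2.
  have [z' [b0z' zz']] := succ_strict rW b0 z.
  exists z'; split=> // b _; split.
    exact: (wo_trans hW (wo_trans hW (h1 b) z1z) zz').
  exact: (wo_trans hW (wo_trans hW (h2 b) z2z) zz').
have [l [lc ml]] := wo_min hW (P := fun l => forall k, ltW (c k) l) (KW c).
have cof u : ltW u l -> exists i, ~ ltW (c i) u.
  by move=> ul; apply: contrapT => n; apply: (ml u) => // k; apply: contrapT => nk; apply: n; exists k.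
have [k0] := rg_pt rK; exists l; split; first exact: (wo_trans hW (cP k0).1 (lc k0)).
split.
  exists c; split; first by move=> i j ij; exact: ((cP j).2 i ij).1.
  by split.
move=> b bl; have [i bi] := cof b bl; have [j ij] := rg_next rK i.
apply: (wo_trans hW (FG b)); apply: (wo_le_lt hW (mG _ _ bi)).
exact: (wo_trans hW ((cP j).2 i ij).2 (lc j)).
Qed.

(** For one i the i-th rung of the ladder has unboundedly many values with stationary preimage;
    these values are the colors. Otherwise let bs bound all such values, for every i, and let D
    diagonalize the functions that refute the values beyond. A point above bs closed under D has a
    rung above bs, and is closed under the function refuting that very value. *)
Theorem Solovay_coloring : exists col : W -> W, forall F j, exists l, kclosed F l /\ col l = j.
Proof.
have e l : exists r, (exists r, ladder ltK ltW l r) -> ladder ltK ltW l r.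
  have [[r hr]|n] := EM (exists r, ladder ltK ltW l r); first by exists r.
  by have [w] := rg_pt rW; exists (fun=> w).
have [r rP] := choice e.
pose U i z := forall F, exists l, kclosed F l /\ r l i = z.
suff [i ui] : exists i, unbounded ltW (U i).
  have [u [ui1 ui2]] := enumerate rW ui.
  have e' l : exists x, forall y, r l i = u y -> x = y.
    have [[y hy]|n] := EM (exists y, r l i = u y).
      exists y => y'; rewrite hy; exact: (incr_inj hW (wo_irr hW) ui1).
    by have [w] := rg_pt rW; exists w => y hy; case: n; exists y.
  have [col colP] := choice e'; exists col => F j.
  by have [l [cl rl]] := ui2 j F; exists l; split=> //; apply: colP.
apply: contrapT => n.
have e1 i : exists b, forall z, U i z -> ltW z b.
  by apply: contrapT => nb; apply: n; exists i; apply/(nbounded rW).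
have [bb bbP] := choice e1; have [bs bsP] := KW bb.
have e2 (iz : K * W) : exists F, ltW (bb iz.1) iz.2 -> forall l, kclosed F l -> r l iz.1 <> iz.2.
  have [lt|nlt] := EM (ltW (bb iz.1) iz.2); last by exists id.
  apply: contrapT => nF; apply: (wo_asym hW lt); apply: bbP => F.
  by apply: contrapT => nl; apply: nF; exists F => _ l cl rl; apply: nl; exists l.
have [FF FFP] := choice e2.
have e3 z : exists M, mono ltW M /\ forall i x, ltW (FF (i, z) x) (M x).
  have [M [mM hM]] := mono_hull rW (fun (i : K) x => FF (i, z) x) all_small.
  by exists M; split=> // i x; apply: hM.
have [M MP] := choice e3.
have e4 b : exists d, forall z, ~ ltW b z -> ltW (M z b) d.
  exact: (small_seg_le rW b (fun z => M z b)).
have [D DP] := choice e4.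
have [l [bsl [ld cl]]] := kclosed_ex D bs.
have [rinc [rl rcof]] := rP l ld.
have [i bi] := rcof bs bsl; have [i' ii'] := rg_next rK i.
have bz : ltW bs (r l i') by exact: (wo_le_lt hW bi (rinc _ _ ii')).
have /= := FFP (i', r l i') (wo_trans hW (bsP i') bz) l; apply=> //; split=> // b bl.
pose m := wo_max ltW b (r l i').
have ml : ltW m l by exact: wo_max_lt.
apply: (wo_trans hW ((MP (r l i')).2 i' b)).
apply: (wo_le_lt hW ((MP (r l i')).1 _ _ (@wo_max_l _ _ hW b (r l i')))).
exact: (wo_trans hW (DP m _ (@wo_max_r _ _ hW b (r l i'))) (cl _ ml)).
Qed.

End Limits.

(** N is the shortest well-order obtained from [K -> Prop] that does not embed into K. *)
Lemma successor_cardinal (K : Type) : le_card nat K ->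
  exists (N : Type) (ltN : N -> N -> Prop), regular ltN /\
    (forall f : K -> N, exists b, forall k, ltN (f k) b) /\
    (forall n, le_card {x | ltN x n} K).
Proof.
move=> inf.
have [N [ltN [hN [seg nN]]]] : exists (N : Type) (ltN : N -> N -> Prop), WO ltN /\
    (forall n, le_card {x | ltN x n} K) /\ ~ le_card N K.
  have [lt h] := zermelo (K -> Prop).
  have [[x0 nx0]|n] := EM (exists x, ~ le_card {y | lt y x} K); last first.
    exists (K -> Prop), lt; split=> //; split; last exact: Cantor_diagonal.
    by move=> x; apply: contrapT => nx; apply: n; exists x.
  have [x [nx mx]] := wo_min h (ex_intro (fun x => ~ le_card {y | lt y x} K) _ nx0).
  exists {y | lt y x}, (restr lt _); split; first exact: WO_sig.
  split=> // -[y yx]; have sy : le_card {z | lt z y} K.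
    by apply: contrapT => ny; exact: (mx y).
  apply: le_card_trans sy; apply: (@le_card_sig _ _ _ _ sval) => // u v _ _.
  exact: sig_eq.
(* If K many values were cofinal, N would be a union of K many segments of size at most K, hence
   would embed into K * K. *)
have bd (I : Type) (S : I -> Prop) (f : I -> N) : le_card {i | S i} K ->
    exists b, forall i, S i -> ltN (f i) b.
  move=> SK; apply: contrapT => n; apply: nN.
  have cov x : exists i, S i /\ ~ ltN (f i) x.
    by apply: contrapT => nx; apply: n; exists x => i Si; apply: contrapT => h; apply: nx; exists i.
  have segle m : le_card {y | ~ ltN m y} K.
    have [c ci] := seg m.
    apply: le_card_trans (hilbert_hotel inf).
    exists (fun u => match pselect (ltN (sval u) m) with
       | left h => Some (c (exist _ (sval u) h)) | right _ => None end).
    move=> [u hu] [v hv] /=; case: pselect => h; case: pselect => h' //.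
      by move=> [/ci [e]]; apply: sig_eq.
    move=> _; apply: sig_eq => /=.
    have eq z : ~ ltN m z -> ~ ltN z m -> z = m by move=> h1 /(wo_nlt hN) [].
    by rewrite (eq u) // (eq v).
  have [c0 _] := inf.
  have segle' m : exists q : N -> K, forall x y, ~ ltN m x -> ~ ltN m y -> q x = q y -> x = y.
    exact: (sig_inj_on (c0 0) (segle m)).
  have [p pP] := choice cov; have [q qP] := choice segle'.
  have [s si] := SK.
  apply: le_card_trans (Hessenberg inf).
  exists (fun x => (s (exist _ (p x) (pP x).1), q (f (p x)) x)).
  move=> x y [/si [e]] e'; apply: (qP (f (p x))); first exact: (pP x).2.
    by rewrite e; exact: (pP y).2.
  by rewrite e' e.
exists N, ltN; split; last split=> //.
- split=> //.
  + apply: contrapT => n; apply: nN; exists (fun x => match n (inhabits x) with end) => x.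
    by case: (n (inhabits x)).
  + move=> x; have [|b hb] := bd unit (fun=> True) (fun=> x); last by exists b; exact: (hb tt).
    have [c ci] := inf; exists (fun=> c 0) => -[[] []] [[] []] //.
  + by move=> a f; apply: bd.
- move=> f; have [|b hb] := bd K (fun=> True) f; first exact: le_card_sigT.
  by exists b => k; apply: hb.
Qed.

(** * Selectors of fibres and their heights *)

Section Fibers.
Variables (K : Type) (ltK : K -> K -> Prop) (rK : regular ltK).
Variables (W : Type) (ltW : W -> W -> Prop) (rW : regular ltW).
Variable g : W -> K -> K.
Hypothesis g_dom : forall u w, ltW u w -> dom ltK (g u) (g w).
Hypothesis g_unb : forall h (V : K -> Prop), unbounded ltK V ->
      exists w, unbounded ltK (fun v => V v /\ ltK (h v) (g w v)).
Let hK := rg_wo rK.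
Let hW := rg_wo rW.
Notation unbounded := (unbounded ltK).
Notation bounded := (bounded ltK).

Definition under (rho : K -> K) l x := ~ ltK (g l (rho x)) x.

(* Modulo bounded sets, l is the least index with Y below g l o rho. *)
Definition height (rho : K -> K) l (Y : K -> Prop) :=
  (forall b, bounded (fun x => Y x /\ ~ ltK b (rho x))) /\
  (forall x, Y x -> under rho l x) /\
  forall u, ltW u l -> bounded (fun x => Y x /\ under rho u x).

Lemma height_disjoint rho l l' Y Y' : height rho l Y -> height rho l' Y' -> l <> l' ->
  bounded (fun x => Y x /\ Y' x).
Proof.
move=> [_ [Y2 Y3]] [_ [Y2' Y3']] n; case: (wo_tri hW l l') => [h|[//|h]].
  by apply: bounded_sub (Y3' _ h) _ => x [/Y2].
by apply: bounded_sub (Y3 _ h) _ => x [Yx /Y2'].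
Qed.

(** From the fibre over v choose [y (z, v)] above [g z v]; F z is an index catching these choices
    unboundedly often. Let l be closed under F with ladder r. The a-th element is chosen for z = r a
    and caught by F (r a), hence by l; over a large v it escapes all [r b] with b < a. *)
Theorem heights rho (X V : K -> Prop) : unbounded V ->
  (forall v, V v -> unbounded (fun x => X x /\ rho x = v)) ->
  exists F : W -> W, forall l, kclosed ltK ltW F l -> exists Y : K -> Prop,
    (forall x, Y x -> X x /\ V (rho x)) /\ unbounded Y /\ height rho l Y.
Proof.
move=> uV fib; have [k0] := rg_pt rK.
have e (zv : W * K) : exists y, V zv.2 -> X y /\ rho y = zv.2 /\ ltK zv.2 y /\ ltK (g zv.1 zv.2) y.
  case: zv => z v /=; have [Vv|nV] := EM (V v); last by exists k0.
  have [c [vc gc]] := succ_strict rK v (g z v).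
  have [y [[Xy ry] cy]] := fib v Vv c; exists y => _; split=> //; split=> //.
  by split; [exact: (wo_trans hK vc cy) | exact: (wo_trans hK gc cy)].
have [y yP] := choice e.
have e' z : exists z', unbounded (fun v => V v /\ ltK (y (z, v)) (g z' v)) by exact: g_unb.
have [F FP] := choice e'; exists F => l [[r [rinc [rl rcof]]] cl].
have e3 a : exists x, [/\ X x, V (rho x), ltK a (rho x), ltK (rho x) x & under rho l x] /\
    forall b, ltK b a -> ~ under rho (r b) x.
  have [c hc] : exists c, forall b, ltK b a -> forall v, ltK c v -> ~ ltK (g (r a) v) (g (r b) v).
    have d b : exists c, ltK b a -> forall v, ltK c v -> ~ ltK (g (r a) v) (g (r b) v).
      have [/rinc /g_dom [c h]|n] := EM (ltK b a); first by exists c.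
      by exists k0.
    have [c cP] := choice d; have [m mP] := rg_bound rK a c; exists m => b ba v mv.
    by apply: (cP b ba); exact: (wo_trans hK (mP b ba) mv).
  have [c' hc'] := g_dom (cl _ (rl a)).
  have [m1 [am1 cm1]] := succ_strict rK a c; have [m [m1m c'm]] := succ_strict rK m1 c'.
  have [v [[Vv yv] mv]] := FP (r a) m.
  have [Xy [ry [vy gy]]] := yP (r a, v) Vv; rewrite /= in ry vy gy.
  exists (y (r a, v)); rewrite /under ry; split.
    split=> //.
      exact: (wo_trans hK am1 (wo_trans hK m1m mv)).
    move=> gl; apply: (hc' v (wo_trans hK c'm mv)); exact: (wo_trans hK gl yv).
  move=> b ba; apply; apply: (wo_le_lt hK _ gy); apply: (hc b ba).
  exact: (wo_trans hK cm1 (wo_trans hK m1m mv)).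
have [x xP] := choice e3.
exists (fun z => exists a, x a = z); split.
  by move=> _ [a <-]; have [[]] := xP a.
split.
  move=> b; exists (x b); split; first by exists b.
  have [[_ _ h1 h2 _] _] := xP b; exact: (wo_trans hK h1 h2).
have seg c : bounded (fun z => exists a, ~ ltK c a /\ x a = z).
  have [m hm] := small_seg_le rK c x; exists m => _ [a [ca <-]]; exact: hm.
split; last split.
- move=> b; apply: bounded_sub (seg b) _ => _ [[a <-] nb]; exists a; split=> //.
  have [[_ _ h _ _] _] := xP a => ba; apply: nb; exact: (wo_trans hK ba h).
- by move=> _ [a <-]; have [[]] := xP a.
- move=> u ul; have [i ui] := rcof u ul.
  have [c hc] : exists c, forall v, ltK c v -> ~ ltK (g (r i) v) (g u v).
    case: (wo_nlt hW ui) => [<-|/g_dom //]; exists k0 => v _; exact: (wo_irr hK).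
  have [m [im cm]] := succ_strict rK i c.
  apply: bounded_sub (seg m) _ => _ [[a <-] uu]; exists a; split=> // ma.
  have [[_ _ h _ _] h'] := xP a.
  apply: (h' i (wo_trans hK im ma)) => gi; apply: uu.
  apply: (wo_le_lt hK _ gi); apply: hc.
  exact: (wo_trans hK cm (wo_trans hK ma h)).
Qed.

End Fibers.

(** * Continuous images of the successor cardinal *)

Section Continuous.
Variables (K : Type) (ltK : K -> K -> Prop) (rK : regular ltK).
Variables (W : Type) (ltW : W -> W -> Prop) (rW : regular ltW).
Hypothesis KW : forall f : K -> W, exists b, forall k, ltW (f k) b.
Variables (N : Type) (ltN : N -> N -> Prop) (rN : regular ltN).
Hypothesis segN : forall n, le_card {x | ltN x n} K.
Let hK := rg_wo rK.
Let hW := rg_wo rW.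
Let hN := rg_wo rN.

(* [o = Some d] means that e is cofinal in d, [o = None] that it is cofinal in W. *)
Definition reaches (o : option W) (e : N -> W) := match o with
  | Some d => (forall i, ltW (e i) d) /\ forall u, ltW u d -> exists i, ~ ltW (e i) u
  | None => forall u, exists i, ~ ltW (e i) u
  end.

Definition continuous_path o (e : N -> W) :=
  (forall i j, ltN i j -> ltW (e i) (e j)) /\ reaches o e /\
  forall i, (exists r, ladder ltK ltN i r) -> forall u, ltW u (e i) ->
    exists j, ltN j i /\ ~ ltW (e j) u.

(** Recursion gives a continuous path d adapted to F, but there are too many F to keep all these
    paths. The stored path with the same supremum does as well: that supremum is closed under G, so
    G of a term is overtaken by a later term, whose index is F'. The dependence on F is moved to
    N. *)
Theorem continuous_paths : exists E : option W -> N -> W, forall F : W -> W,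
  exists o (F' : N -> N), (forall i j, ltN i j -> ltW (E o i) (E o j)) /\
    forall i, kclosed ltK ltN F' i -> kclosed ltK ltW F (E o i).
Proof.
have [w0] := rg_pt rW.
have ex o : exists e, (exists e, continuous_path o e) -> continuous_path o e.
  have [[e he]|n] := EM (exists e, continuous_path o e); first by exists e.
  by exists (fun=> w0).
have [E EP] := choice ex; exists E => F.
have [G [mG FG]] := mono_above rW F.
pose above i (f : N -> W) z := forall j, ltN j i -> ltW (f j) z /\ ltW (G (f j)) z.
pose R i f z := above i f z /\ forall z', above i f z' -> ~ ltW z' z.
have aboveE i f f' z : (forall j, ltN j i -> f j = f' j) -> above i f z -> above i f' z.
  by move=> ff' h j ji; rewrite -ff' //; exact: h.
have [d dP] : exists d, forall i, R i d (d i).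
  apply: (wf_choice (rg_pt rW) (wo_wf hN)) => [i f f' z ff' [h1 h2]|i f _].
    split; first exact: aboveE h1.
    by move=> z' h; apply: h2; apply: aboveE h => j /ff'.
  apply: (wo_min hW); have sm := small_le_card KW (rg_pt rW) (segN i).
  have [z1 h1] := sm f; have [z2 h2] := sm (fun j => G (f j)).
  have [z [z1z z2z]] := succ_strict rW z1 z2; exists z => j ji; split.
    exact: (wo_trans hW (h1 j ji) z1z).
  exact: (wo_trans hW (h2 j ji) z2z).
have dinc i j : ltN i j -> ltW (d i) (d j) by move=> ij; exact: ((dP j).1 i ij).1.
have dG i j : ltN i j -> ltW (G (d i)) (d j) by move=> ij; exact: ((dP j).1 i ij).2.
have dcont i : (exists r, ladder ltK ltN i r) -> forall u, ltW u (d i) ->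
    exists j, ltN j i /\ ~ ltW (d j) u.
  move=> [r [rinc [rl rcof]]] u ud; apply: contrapT => n; apply: ((dP i).2 u) ud => j ji.
  have lt j' : ltN j' i -> ltW (d j') u.
    by move=> j'i; apply: contrapT => h; apply: n; exists j'.
  split; first exact: lt.
  have [k jk] := rcof j ji; have [k' kk'] := rg_next rK k.
  have jj : ltN j (r k') by exact: (wo_le_lt hN jk (rinc _ _ kk')).
  exact: (wo_trans hW (dG _ _ jj) (lt _ (rl k'))).
have [o po] : exists o, continuous_path o d.
  have [[b hb]|n] := EM (exists b, forall i, ltW (d i) b).
    have [l [lc ml]] := wo_min hW (ex_intro (fun l => forall i, ltW (d i) l) b hb).
    exists (Some l); split=> //; split=> //; split=> // u ul.
    apply: contrapT => h; apply: (ml u) => // k; apply: contrapT => nk; apply: h; by exists k.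
  exists None; split=> //; split=> // u; apply: contrapT => h; apply: n; exists u => i.
  by apply: contrapT => nk; apply: h; exists i.
have [Einc [Er Econt]] := EP o (ex_intro _ d po).
have e3 i : exists j, ~ ltW (E o j) (G (E o i)).
  case: o po Er {Einc Econt} => [l|] po Er; last exact: Er.
  apply: Er.2; have [_ [[dl dcof] _]] := po.
  have [k ek] := dcof _ (Er.1 i); have [k' kk'] := rg_next rN k.
  apply: (wo_le_lt hW (mG _ _ ek)); exact: (wo_trans hW (dG _ _ kk') (dl k')).
have [F' F'P] := choice e3; exists o, F'; split=> // i [[r [rinc [rl rcof]]] cl].
split.
  exists (fun k => E o (r k)); split; first by move=> a b /rinc /Einc.
  split; first by move=> k; exact: Einc.
  move=> u ui; have [j [ji ju]] := Econt i (ex_intro _ r (conj rinc (conj rl rcof))) u ui.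
  have [k jk] := rcof j ji; exists k; apply: (wo_le_trans hW ju).
  by case: (wo_nlt hN jk) => [->|/Einc h]; [exact: (wo_irr hW) | exact: (wo_asym hW h)].
move=> b bi; have [j [ji jb]] := Econt i (ex_intro _ r (conj rinc (conj rl rcof))) b bi.
apply: (wo_trans hW (FG b)); apply: (wo_le_lt hW (mG _ _ jb)).
exact: (wo_le_lt hW (F'P j) (Einc _ _ (cl j ji))).
Qed.

Lemma continuous_path_inj : exists f : N -> W, forall i j, ltN i j -> ltW (f i) (f j).
Proof. by have [E EP] := continuous_paths; have [o [F' [h _]]] := EP id; exists (E o). Qed.

End Continuous.

(** * Functions taking every value on a given unbounded set *)

Lemma bounded_le_card (K N : Type) (ltN : N -> N -> Prop) : regular ltN ->
  (forall f : K -> N, exists b, forall k, ltN (f k) b) -> le_card K N.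
Proof.
move=> rN KN; apply: contrapT => /nle_card NK.
have [|b hb] := small_le_card (S := fun=> True) KN (rg_pt rN) _ id.
  exact: le_card_trans (le_card_sigT _) NK.
exact: (wo_irr (rg_wo rN) (hb b I)).
Qed.

Section Splitting.
Variables (K : Type) (ltK : K -> K -> Prop) (rK : regular ltK).
Hypothesis unc : small ltK (fun _ : nat => True).
Variables (W : Type) (ltW : W -> W -> Prop) (rW : regular ltW).
Hypothesis KW : forall f : K -> W, exists b, forall k, ltW (f k) b.
Variable g : W -> K -> K.
Hypothesis g_mono : forall w, mono ltK (g w).
Hypothesis g_dom : forall u w, ltW u w -> dom ltK (g u) (g w).
Hypothesis g_unb : forall h (V : K -> Prop), unbounded ltK V ->
      exists w, unbounded ltK (fun v => V v /\ ltK (h v) (g w v)).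
Variable lad : W -> K -> W.
Hypothesis lad_ok : forall d, (exists l, ladder ltK ltW d l) -> ladder ltK ltW d (lad d).
Variables (N : Type) (ltN : N -> N -> Prop) (rN : regular ltN).
Hypothesis KN : forall f : K -> N, exists b, forall k, ltN (f k) b.
Hypothesis segN : forall n, le_card {x | ltN x n} K.
Let hK := rg_wo rK.
Let hW := rg_wo rW.
Let hN := rg_wo rN.
Notation unbounded := (unbounded ltK).
Notation bounded := (bounded ltK).
Notation drop := (drop rK g).
Notation jump := (jump ltK g).
Notation descend := (descend rK g).
Notation rank := (rank rK g lad).
Notation typ := (typ rK ltW g).

Definition slot_rank (s : list W) d x := rank d (descend s x).

Lemma drop_bounded w b : bounded (fun x => jump w x /\ ~ ltK b (drop w x)).
Proof.
have [c gc] := rg_next rK (g w b); exists c => x [j nb].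
have [_ [h _]] := dropP rK (g := g) j.
apply: (wo_le_lt hK _ gc) => gx; exact: (g_mono nb (wo_lt_le hK gx h)).
Qed.

Lemma drop_le w b x : ltK b x -> ~ ltK (g w b) x -> jump w x /\ ~ ltK b (drop w x).
Proof.
move=> bx gb; have j : jump w x by exists b.
by split=> //; have [_ [_ h]] := dropP rK (g := g) j; exact: h.
Qed.

Lemma good_fibers X : unbounded X -> exists s d X', (forall x, X' x -> X x) /\ typ s X' /\
  (forall x, X' x -> jump d (descend s x)) /\ ladder ltK ltW d (lad d) /\
  exists V, unbounded V /\ forall v, V v -> unbounded (fun x => X' x /\ slot_rank s d x = v).
Proof.
move=> uX; have [s [d [X' [sub [t [ld u]]]]]] := good_slot rK unc rW KW g_mono g_dom g_unb lad_ok uX.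
exists s, d, (fun x => X' x /\ jump d (descend s x)).
split; first by move=> x [/sub].
split; first by apply: typ_sub t => x [].
split; first by move=> x [].
split=> //; eexists; split; first exact: u.
move=> v uv; apply: (unbounded_sub uv) => x [X'x [j [_ e]]]; by [].
Qed.

Let Par : Type := (list W * W * (option W * N * W))%type.

(* The value at v is the color of the least i < c with v below g (E o i) o rho, where only those i
   are taken into account whose code is less than drop w v. For large w this bound grows so slowly
   that, on the selectors used, the least such i is their height. *)
Theorem full_functions : exists H : Par -> K -> K, forall V, unbounded V ->
  exists t, forall j, unbounded (fun v => V v /\ H t v = j).
Proof.
have [k0] := rg_pt rK; have [n0] := rg_pt rN.
have [E EP] := continuous_paths rK rW KW rN segN.
have [col colP] := Solovay_coloring rK rN KN.
have [iota iotaI] := bounded_le_card rN KN.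
have e1 c : exists eps : N -> K, forall i j, ltN i c -> ltN j c -> eps i = eps j -> i = j.
  exact: sig_inj_on k0 (segN c).
have [eps epsP] := choice e1.
pose cand (t : Par) v i := let: (s, d, (o, c, w)) := t in
  ltN i c /\ ltK (eps c i) (drop w v) /\ under ltK g (slot_rank s d) (E o i) v.
pose out t v j := exists i, cand t v i /\ (forall i', cand t v i' -> ~ ltN i' i) /\ col i = iota j.
have e2 (tv : Par * K) : exists j, forall j', out tv.1 tv.2 j' -> j = j'.
  have [[j [i [ci [mi hi]]]]|n] := EM (exists j, out tv.1 tv.2 j).
    exists j => j' [i' [ci' [mi' hi']]]; apply: iotaI; rewrite -hi -hi'; congr col.
    exact: (wo_le_antisym hN (mi _ ci') (mi' _ ci)).
  by exists k0 => j hj; case: n; exists j.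
have [H HP] := choice e2; exists (fun t v => H (t, v)) => V uV.
have [s [d [X' [sub [ts [_ [_ [U [uU fib]]]]]]]]] := good_fibers uV.
have [|F FP] := @heights _ _ rK _ _ rW g g_dom g_unb (slot_rank s d) V U uU.
  by move=> v /fib u; apply: (unbounded_sub u) => x [/sub].
have [o [F' [Einc EF]]] := EP F.
have e3 j : exists i, kclosed ltK ltN F' i /\ col i = iota j by exact: colP.
have [l lP] := choice e3.
have [c cP] := KN l.
have e4 j : exists Y : K -> Prop, (forall x, Y x -> V x) /\ unbounded Y /\
    height ltK ltW g (slot_rank s d) (E o (l j)) Y.
  have [Y [YV [uY hY]]] := FP _ (EF _ (lP j).1).
  by exists Y; split=> // x /YV [].
have [Y YP] := choice e4.
have e5 (ji : K * N) : exists b, ltN ji.2 (l ji.1) ->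
    forall v, Y ji.1 v -> under ltK g (slot_rank s d) (E o ji.2) v -> ltK v b.
  case: ji => j i /=; have [il|n] := EM (ltN i (l j)); last by exists k0.
  have [_ [_ [_ [_ h]]]] := YP j; have [b hb] := h _ (Einc _ _ il).
  by exists b => _ v Yv uv; apply: hb.
have [bj bjP] := choice e5.
have sm a : small ltK (fun i => ltN i c /\ ltK (eps c i) a).
  have e6 k : exists i, forall i', ltN i' c -> eps c i' = k -> i = i'.
    have [[i [ic ek]]|n] := EM (exists i, ltN i c /\ eps c i = k).
      by exists i => i' i'c e'; apply: (epsP c) => //; rewrite ek.
    by exists n0 => i ic e; case: n; exists i.
  have [inv invP] := choice e6.
  apply: (small_image (f := inv) (small_seg rK a)) => i [ic ea].
  by exists (eps c i); split=> //; exact: invP.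
have e7 (ja : K * K) : exists v, [/\ Y ja.1 v, ltK ja.2 v & forall i, ltN i (l ja.1) ->
    ltK (eps c i) ja.2 -> ltN i c -> ltK (bj (ja.1, i)) v].
  case: ja => j a /=; have [b hb] := sm a (fun i => bj (j, i)).
  have [b' [bb' ab']] := succ_strict rK b a.
  have [v [Yv b'v]] := (YP j).2.1 b'; exists v; split=> //.
    exact: (wo_trans hK ab' b'v).
  move=> i il ea ic; apply: (wo_trans hK (hb i (conj ic ea))).
  exact: (wo_trans hK bb' b'v).
have [nx nxP] := choice e7.
(* For v = nx (j, a) below [g w a] the drop of v at w is at most a. Hence every candidate has a code
   below a, and v was chosen beyond the bounds of those that precede [l j]. *)
have e8 j : exists w, unbounded (fun a => True /\ ltK (nx (j, a)) (g w a)).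
  by apply: g_unb => b; have [a ba] := rg_next rK b; exists a.
have [th thP] := choice e8; have [w thw] := KW th.
exists (s, d, (o, c, w)) => j b.
have [b1 hb1] := g_dom (thw j).
have [b2 hb2] := drop_bounded w (eps c (l j)).
have [m1 [bm b1m]] := succ_strict rK b b1; have [m [m1m b2m]] := succ_strict rK m1 b2.
have [a [[_ na] ma]] := thP j m.
have [Yv av hv] := nxP (j, a); rewrite /= in Yv av hv.
have mv : ltK m (nx (j, a)) by exact: (wo_trans hK ma av).
set v := nx (j, a) in na Yv av hv mv *.
have gw : ~ ltK (g w a) v.
  move=> gv; apply: (hb1 a (wo_trans hK b1m (wo_trans hK m1m ma))).
  exact: (wo_trans hK gv na).
have [jv dv] := drop_le av gw.
exists v; split; last exact: (wo_trans hK bm (wo_trans hK m1m mv)).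
split; first exact: (YP j).1.
apply: (HP ((s, d, (o, c, w)), v)); exists (l j); split.
  split; first exact: cP.
  split; last exact: (YP j).2.2.2.1.
  apply: contrapT => nd; apply: (wo_asym hK (wo_trans hK b2m mv)); exact: hb2.
split; last exact: (lP j).2.
move=> i [ic [ei ui]] il.
have h1 : ltK (bj (j, i)) v by apply: hv => //; exact: (wo_lt_le hK ei dv).
exact: (wo_asym hK h1 (bjP (j, i) il v Yv ui)).
Qed.

End Splitting.

(** * Almost disjoint codes *)

Section Codes.
Variables (K : Type) (ltK : K -> K -> Prop) (rK : regular ltK).
Hypothesis unc : small ltK (fun _ : nat => True).
Hypothesis inf : le_card nat K.
Let hK := rg_wo rK.
Notation unbounded := (unbounded ltK).
Notation bounded := (bounded ltK).

Lemma initial_segment_codes : two_lt_eq ltK -> exists J : K -> (K -> Prop) -> K,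
  forall a a' S S', J a S = J a' S' -> a = a' /\ forall x, ltK x a -> (S x <-> S' x).
Proof.
move=> [h _].
have e a : exists j : (K -> Prop) -> K, forall S S', j S = j S' ->
    forall x, ltK x a -> (S x <-> S' x).
  have [f fi] := h a; exists (fun S => f (fun u => S (sval u))) => S S' /fi e x xa.
  by have := f_equal (fun P => P (exist _ x xa)) e => /= ->.
have [j jP] := choice e; have [p pi] := Hessenberg inf.
exists (fun a S => p (a, j a S)) => a a' S S' /pi [e1]; subst a' => ej; split=> //; exact: jP ej.
Qed.

(** A name is a tuple (s, d, l, S), and two different names of one family are separated by the
    labels, by the height, or by Q. Only [length s] goes into the number of the family, as
    [typ_disjoint] compares sequences of equal length. *)
Theorem codes_exist : two_lt_eq ltK \/ two_pow_succ K ->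
  exists (C : Type) (Code : nat -> (K -> Prop) -> C -> Prop),
    (forall n Y Y' c c', Code n Y c -> Code n Y' c' -> c <> c' ->
       bounded (fun x => Y x /\ Y' x)) /\
    forall X, unbounded X -> exists n, le_card (K -> Prop)
      {c | exists Y, (forall x, Y x -> X x) /\ unbounded Y /\ Code n Y c}.
Proof.
move=> H2.
have [k0] := rg_pt rK.
have [W [ltW [g [rW [KW [g_mono [g_dom g_unb]]]]]]] := scale_exists rK.
have [N [ltN [rN [KN segN]]]] := successor_cardinal inf.
have hW := rg_wo rW.
have e0 d : exists l, (exists l, ladder ltK ltW d l) -> ladder ltK ltW d l.
  have [[l hl]|n] := EM (exists l, ladder ltK ltW d l); first by exists l.
  by have [w] := rg_pt rW; exists (fun=> w).
have [lad lad_ok] := choice e0.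
pose Typ := typ rK ltW g; pose rho := slot_rank rK g lad.
pose C : Type := (list W * W * W * (K -> Prop))%type.
(* Q governs the last component of the name. If 2^kappa = kappa^+ it is held constant, since the
   heights alone are more than kappa many; otherwise it is an arbitrary subset of K. *)
suff [Q [Qdisj Qrich]] : exists Q : list W -> W -> W -> (K -> Prop) -> (K -> Prop) -> Prop,
    (forall s d l S S' (Y Y' : K -> Prop), Q s d l S Y -> Q s d l S' Y' -> S <> S' ->
       bounded (fun x => Y x /\ Y' x)) /\
    forall s d (X V : K -> Prop), unbounded V ->
      (forall v, V v -> unbounded (fun x => X x /\ rho s d x = v)) ->
      le_card (K -> Prop) {lS : W * (K -> Prop) | exists Y, (forall x, Y x -> X x) /\
        unbounded Y /\ height ltK ltW g (rho s d) lS.1 Y /\ Q s d lS.1 lS.2 Y}.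
  exists C, (fun n Y c => let: (s, d, l, A) := c in length s = n /\ Typ (d :: s) Y /\
    height ltK ltW g (rho s d) l Y /\ Q s d l A Y).
  split.
    move=> n Y Y' [[[s d] l] S] [[[s' d'] l'] S'] [ls [t [h q]]] [ls' [t' [h' q']]] nc.
    have [e|ne] := EM (d :: s = d' :: s'); last first.
      by apply: (typ_disjoint rW _ ne t t'); rewrite /= ls ls'.
    case: e => e1 e2; subst d' s'.
    have [e|ne] := EM (l = l'); last exact: (height_disjoint rW h h' ne).
    subst l'; apply: (Qdisj _ _ _ _ _ _ _ q q') => e; apply: nc; by rewrite e.
  move=> X uX.
  have [s [d [X' [sub [ts [jd [ld [V [uV fib]]]]]]]]] :=
    good_fibers rK unc rW KW g_mono g_dom g_unb lad_ok uX.
  exists (length s); apply: le_card_trans (Qrich s d X' V uV fib) _.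
  apply: (@le_card_sig _ _ _ _ (fun lS : W * (K -> Prop) => ((s, d, lS.1, lS.2) : C))).
    move=> [l S] [Y [YX [uY [h q]]]]; exists Y; split; first by move=> x /YX /sub.
    split=> //; split=> //; split; last by [].
    apply: (rank_type rW g_mono g_dom ld).
    - exact: typ_sub YX ts.
    - by move=> x /YX /jd.
    - exact: h.1.
  by move=> [l S] [l' S'] _ _ /= [-> ->].
case: H2 => [|[_ succ]]; last first.
  exists (fun _ _ _ S _ => S = fun=> True); split.
    by move=> s d l S S' Y Y' -> ->.
  move=> s d X V uV fib; have [F FP] := heights rK rW g_dom g_unb uV fib.
  apply: succ.
  suff n : ~ le_card {lS : W * (K -> Prop) | exists Y, (forall x, Y x -> X x) /\
        unbounded Y /\ height ltK ltW g (rho s d) lS.1 Y /\ lS.2 = fun=> True} K.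
    by split=> //; exact: nle_card.
  move=> h; have [|b hb] := small_le_card (S := kclosed ltK ltW F) KW (rg_pt rW) _ id.
    apply: le_card_trans h.
    apply: (@le_card_sig _ _ _ _ (fun l : W => (l, fun _ : K => True))).
      move=> l /FP [Y [YX [uY hY]]]; exists Y; split=> //; by move=> x /YX [].
    by move=> x y _ _ [].
  have [l [bl cl]] := kclosed_ex rK rW KW F b.
  exact: (wo_asym hW bl (hb l cl)).
move=> /initial_segment_codes [J JP].
have [H HP] := full_functions rK unc rW KW g_mono g_dom g_unb lad_ok rN KN segN.
have [col colP] := Solovay_coloring rK rW KW.
pose Par : Type := (list W * W * (option W * N * W))%type.
have infW : le_card nat W := le_card_trans inf (bounded_le_card rW KW).
have [dec decP] : exists dec : W -> Par, forall t, exists w, dec w = t.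
  have [f fi] : le_card Par W.
    have WW := Hessenberg infW.
    have lo := hilbert_hotel infW.
    have NW : le_card N W.
      have [f fi] := continuous_path_inj rK rW KW rN segN; exists f.
      exact: (incr_inj (rg_wo rN) (wo_irr hW) fi).
    apply: (le_card_trans (le_card_prod _ _) WW).
      exact: le_card_trans (le_card_prod (le_card_list infW) (le_card_refl W)) WW.
    apply: (le_card_trans (le_card_prod _ (le_card_refl W)) WW).
    exact: le_card_trans (le_card_prod lo NW) WW.
  have [w0] := rg_pt rW; have [n0] := rg_pt rN.
  have e w : exists t, forall t', f t' = w -> t = t'.
    have [[t ft]|n] := EM (exists t, f t = w).
      by exists t => t' ft'; apply: fi; rewrite ft.
    by exists ([], w0, (None, n0, w0)) => t ft; case: n; exists t.
  have [dec decP] := choice e; exists dec => t; exists (f t); exact: decP.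
(* The function named by the height l tends to S along Y. *)
exists (fun s d l S Y => forall b, bounded (fun y => Y y /\
  ~ exists a, ltK b a /\ H (dec (col l)) (rho s d y) = J a S)).
split.
  move=> s d l S S' Y Y' q q' nS.
  have [b nb] : exists b, ~ (S b <-> S' b).
    apply: contrapT => n; apply: nS; apply: funext => b; apply: propext.
    by apply: contrapT => nb; apply: n; exists b.
  apply: bounded_sub (bounded_or rK (q b) (q' b)) _ => x [Yx Y'x].
  apply: contrapT => n.
  have [a [ba ha]] : exists a, ltK b a /\ H (dec (col l)) (rho s d x) = J a S.
    by apply: contrapT => n'; apply: n; left.
  have [a' [ba' ha']] : exists a, ltK b a /\ H (dec (col l)) (rho s d x) = J a S'.
    by apply: contrapT => n'; apply: n; right.
  by apply: nb; move: ha; rewrite ha' => /JP [-> h]; have [h1 h2] := h b ba; split.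
move=> s d X V uV fib; have [t tP] := HP V uV; have [w decw] := decP t.
have e S : exists l, exists Y : K -> Prop, (forall x, Y x -> X x) /\
    unbounded Y /\ height ltK ltW g (rho s d) l Y /\ forall b, bounded (fun y => Y y /\
      ~ exists a, ltK b a /\ H (dec (col l)) (rho s d y) = J a S).
  (* Only fibres over the points [v a], where H t takes the value [J a S], are kept: as a grows,
     these values determine more and more of S. *)
  have e1 a : exists v, (V v /\ H t v = J a S) /\ ltK a v by exact: tP.
  have [v vP] := choice e1.
  have [|v' | F FP] := @heights _ _ rK _ _ rW g g_dom g_unb (rho s d) X (fun x => exists a, v a = x).
  - by move=> b; exists (v b); split; [exists b | exact: (vP b).2].
  - by move=> [a <-]; apply: fib; exact: (vP a).1.1.
  have [l [cl ll]] := colP F w; have [Y [YX [uY hY]]] := FP l cl.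
  exists l, Y; split; first by move=> x /YX [].
  split=> //; split=> // b; rewrite ll decw.
  have [m hm] := small_seg_le rK b v.
  apply: bounded_sub (hY.1 m) _ => y [Yy n]; split=> // my; apply: n.
  have [_ [a va]] := YX y Yy; exists a; rewrite -va (vP a).1.2; split=> //.
  apply: contrapT => nba; apply: (wo_asym hK my); rewrite -va; exact: hm.
have [l lP] := choice e.
exists (fun S => exist (fun lS : W * (K -> Prop) => exists Y : K -> Prop, (forall x, Y x -> X x) /\
   unbounded Y /\ height ltK ltW g (rho s d) lS.1 Y /\ forall b, bounded (fun y => Y y /\
      ~ exists a, ltK b a /\ H (dec (col lS.1)) (rho s d y) = J a lS.2)) (l S, S) (lP S)).
by move=> S S' /(f_equal sval) [].
Qed.

End Codes.

(** * Copies of a sum of blocks *)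

(** The supremum of a countable sequence in which each term exceeds a monotone bound of J at the
    previous one; it exists because countable sequences are bounded. *)
Lemma closure_points (K : Type) (ltK : K -> K -> Prop) (J : K -> K) : regular ltK ->
  small ltK (fun _ : nat => True) ->
  unbounded ltK (fun i => forall i', ltK i' i -> ltK (J i') i).
Proof.
move=> rK unc b; have hK := rg_wo rK.
have [G [mG JG]] := mono_above rK J.
have [s sP] := choice (fun x => succ_strict rK x (G x)).
pose c := fix c n := match n with 0 => s b | S n => s (c n) end.
have cS n : ltK (c n) (c (S n)) by exact: (sP (c n)).1.
have [m mc] := unc c.
have [l [lc ml]] := wo_min hK (ex_intro (fun l => forall n, ltK (c n) l) m (fun n => mc n I)).
exists l; split; last exact: (wo_trans hK (sP b).1 (lc 0)).
move=> i il; have [n ni] : exists n, ~ ltK (c n) i.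
  apply: contrapT => h; apply: (ml i) => // n; apply: contrapT => ni; apply: h; by exists n.
apply: (wo_trans hK (JG i)); apply: (wo_le_lt hK (mG _ _ ni)).
exact: (wo_trans hK (sP (c n)).2 (lc (S n))).
Qed.

Section Blocks.
Variables (L : Type) (ltL : L -> L -> Prop) (hL : WO ltL).
Variables (K : Type) (ltK : K -> K -> Prop) (rK : regular ltK).
Hypothesis unc : small ltK (fun _ : nat => True).
Variable blk : L -> K.
Hypothesis blk_mono : forall x y, ltL x y -> ~ ltK (blk y) (blk x).
Hypothesis blk_onto : forall i, exists x, blk x = i.
Hypothesis blk_embed : forall i i' h, ~ ltK i' i -> blk h = i' -> exists f : L -> L,
  (forall x y, blk x = i -> blk y = i -> ltL x y -> ltL (f x) (f y)) /\
  forall x, blk x = i -> blk (f x) = i' /\ ~ ltL (f x) h.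
(** A block has a last element, as when it is a single point, or fewer than K of its elements are
    always bounded in it; the indices up to j0 stand for fewer than K. *)
Hypothesis blk_cof : forall i,
  (exists h, blk h = i /\ forall x, blk x = i -> ~ ltL h x) \/
  forall j0 (f : K -> L), (forall j, ~ ltK j0 j -> blk (f j) = i) ->
    exists h, blk h = i /\ forall j, ~ ltK j0 j -> ltL (f j) h.
Let hK := rg_wo rK.

Definition positive (A : L -> Prop) :=
  exists f : L -> L, (forall x y, ltL x y -> ltL (f x) (f y)) /\ forall x, A (f x).

Lemma blk_lt x y : ltK (blk x) (blk y) -> ltL x y.
Proof.
move=> h; case: (wo_tri hL x y) => [//|[e|/blk_mono]]; last by [].
by subst y; case: (wo_irr hK h).
Qed.

Lemma blk_le x y : ~ ltL y x -> ~ ltK (blk y) (blk x).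
Proof. by move=> /(wo_nlt hL) [->|/blk_mono //]; exact: (wo_irr hK). Qed.

(* A copy of L contains a tail of a copy of each block inside a single block, since blocks
   have large cofinality. *)
Lemma positive_blocks A : positive A -> forall i, exists j, ~ ltK j i /\ exists f : L -> L,
  (forall x y, blk x = i -> blk y = i -> ltL x y -> ltL (f x) (f y)) /\
  forall x, blk x = i -> A (f x) /\ blk (f x) = j.
Proof.
move=> [f [fi fA]] i.
have [i' ii'] := rg_next rK i; have [y0 by0] := blk_onto i'.
pose j0 := blk (f y0).
have le0 x : blk x = i -> ~ ltK j0 (blk (f x)).
  by move=> bx; apply: blk_mono; apply: fi; apply: blk_lt; rewrite bx by0.
have [j [h [bh hj]]] : exists j h, blk h = i /\ forall x, blk x = i -> ~ ltL x h -> blk (f x) = j.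
  case: (blk_cof i) => [[h [bh mh]]|cof].
    exists (blk (f h)), h; split=> // x bx xh; congr (blk (f _)).
    exact: (wo_le_antisym hL (mh _ bx) xh).
  have [j nj] : exists j, forall b, blk b = i -> exists x, blk x = i /\ blk (f x) = j /\ ltL b x.
    apply: contrapT => n.
    have e j : exists b, blk b = i /\ forall x, blk x = i -> blk (f x) = j -> ~ ltL b x.
      apply: contrapT => nb; apply: n; exists j => b bb; apply: contrapT => nx; apply: nb.
      by exists b; split=> // x bx fx bx'; apply: nx; exists x.
    have [b bP] := choice e; have [|h [bh hh]] := cof j0 b; first by move=> j _; exact: (bP j).1.
    exact: ((bP (blk (f h))).2 h bh erefl (hh _ (le0 h bh))).
  have [b bb] := blk_onto i; have [h [bh [fh _]]] := nj b bb.
  exists j, h; split=> // x bx xh; have [x' [bx' [fx' xx']]] := nj x bx.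
  apply: (wo_le_antisym hK); first by rewrite -fx'; apply: blk_mono; exact: fi.
  rewrite -fh; apply: blk_le => l; case: (wo_nlt hL xh) => [e|/fi l'].
    by subst x; exact: (wo_irr hL l).
  exact: (wo_asym hL l l').
have [e [ei eP]] := blk_embed (wo_irr hK (x := i)) bh.
exists j; split.
  rewrite -(hj h bh (wo_irr hL (x := h))) -bh; apply: blk_le; exact: (incr_ge hL fi).
exists (fun x => f (e x)); split; first by move=> x y bx bby xy; apply: fi; exact: ei.
by move=> x bx; split=> //; have [b1 b2] := eP x bx; exact: hj.
Qed.

(** Y consists of the J i for closure points i of J. Block i is sent into block u i, an admissible
    closure point, and from there into A in block J (u i). Blocks stay in order, because J (u i)
    lies below every later closure point. *)
Theorem positive_trace A : positive A -> exists Y, unbounded ltK Y /\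
  forall a : K -> Prop, unbounded ltK a -> (forall i, a i -> Y i) ->
    positive (fun x => A x /\ a (blk x)).
Proof.
move=> pA; have [J JP] := choice (positive_blocks pA).
have uE := closure_points J rK unc.
pose E i := forall i', ltK i' i -> ltK (J i') i.
exists (fun j => exists i, E i /\ J i = j); split.
  move=> b; have [i [Ei bi]] := uE b; exists (J i); split; first by exists i.
  exact: (wo_lt_le hK bi (JP i).1).
move=> a ua aY.
have [u [ui uU]] : exists u : K -> K, (forall x y, ltK x y -> ltK (u x) (u y)) /\
    forall x, E (u x) /\ a (J (u x)).
  apply: (enumerate rK (U := fun i => E i /\ a (J i))) => b.
  have [m mJ] := small_seg_le rK b J; have [j [aj mj]] := ua m.
  have [i [Ei ij]] := aY j aj; exists i; split; first by rewrite ij.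
  apply: contrapT => nb; apply: (wo_asym hK mj); rewrite -ij; exact: mJ.
have e i : exists h : L -> L, (forall x y, blk x = i -> blk y = i -> ltL x y -> ltL (h x) (h y)) /\
    forall x, blk x = i -> (A (h x) /\ a (blk (h x))) /\ blk (h x) = J (u i).
  have [y bby] := blk_onto (u i).
  have [h1 [h1i h1b]] := blk_embed (incr_ge hK ui (x := i)) bby.
  have [_ [h2 [h2i h2A]]] := JP (u i).
  exists (fun x => h2 (h1 x)); split.
    move=> x x' bx bx' xx'; apply: h2i; [exact: (h1b x bx).1 | exact: (h1b x' bx').1 | exact: h1i].
  move=> x bx; have [Ah ->] := h2A (h1 x) (h1b x bx).1; split=> //; split=> //; exact: (uU i).2.
have [h hP] := choice e.
exists (fun x => h (blk x) x); split; last by move=> x; exact: ((hP (blk x)).2 x erefl).1.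
move=> x y xy; case: (wo_nlt hK (blk_mono xy)) => [e'|bb].
  by rewrite e'; exact: ((hP (blk x)).1 x y erefl e' xy).
apply: blk_lt; rewrite ((hP (blk x)).2 x erefl).2 ((hP (blk y)).2 y erefl).2.
apply: (wo_lt_le hK _ (JP (u (blk y))).1).
exact: ((uU (blk y)).1 _ (ui _ _ bb)).
Qed.

(** This turns almost disjoint sets of blocks into incompatible conditions. *)
Lemma positive_unbounded A a : positive A -> (forall x, A x -> a (blk x)) -> ~ bounded ltK a.
Proof.
move=> pA Aa [b hb]; have [j [bj [f [_ fA]]]] := positive_blocks pA b.
have [x bx] := blk_onto b; have [Af ej] := fA x bx.
by apply: bj; rewrite -ej; apply: hb; exact: Aa.
Qed.

End Blocks.

(** * The ordinal power of omega *)

Section OmegaPower.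
Variables (D : Type) (lt : D -> D -> Prop) (hD : WO lt).
Notation L := (OmegaPow lt).
Notation ltL := (opw_lt lt).

Definition fn (f : L) : D -> nat := sval f.

Lemma fn_inj (f g : L) : (forall x, fn f x = fn g x) -> f = g.
Proof. by move=> e; apply: sig_eq; apply: funext. Qed.

Lemma finite_max (P : D -> Prop) (l : list D) : (forall x, P x -> In x l) ->
  (exists x, P x) -> exists x, P x /\ forall y, P y -> ~ lt x y.
Proof.
elim: l P => [|a l IH] P Pl [x Px]; first by case: (Pl x Px).
have [[y [Py ya]]|n] := EM (exists y, P y /\ y <> a); last first.
  exists x; split=> // y Py; have -> : y = x; last exact: (wo_irr hD).
  have ea z : P z -> z = a by move=> Pz; apply: contrapT => na; apply: n; exists z.
  by rewrite (ea y) // (ea x).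
have [|z [[Pz za] mz]] := IH (fun y => P y /\ y <> a) _ (ex_intro _ y (conj Py ya)).
  by move=> z [/Pl [->|//]].
have [Pa|nPa] := EM (P a); last first.
  by exists z; split=> // w Pw; apply: mz; split=> // e; subst w.
exists (wo_max lt a z); split; first by rewrite /wo_max; case: (pselect _).
move=> w Pw; have [->|wa] := EM (w = a); first exact: wo_max_l.
by apply: (wo_le_trans hD (mz w (conj Pw wa))); exact: wo_max_r.
Qed.

Definition top (f : L) t := fn f t <> 0 /\ forall y, fn f y <> 0 -> ~ lt t y.

Lemma top_ex f : (exists x, fn f x <> 0) -> exists t, top f t.
Proof. by case: (proj2_sig f) => l hl; exact: finite_max hl. Qed.

Lemma top_zero f t y : top f t -> lt t y -> fn f y = 0.
Proof. by move=> [_ h] ty; apply: contrapT => n; exact: (h y n). Qed.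

Lemma opw_top f g t : ltL f g -> top g t -> forall y, lt t y -> fn f y = 0.
Proof.
move=> [x [fgx h]] tg y ty; rewrite /fn h; first exact: (top_zero tg ty).
apply: (wo_le_lt hD _ ty) => tx; have := top_zero tg tx; rewrite /fn; lia.
Qed.

Definition low (t : D) (Q : L -> Prop) := forall f, Q f -> forall x, ~ lt x t -> fn f x = 0.

Definition has_min (Q : L -> Prop) := exists f, Q f /\ forall g, Q g -> ~ ltL g f.

Lemma opw_asym f g : ltL f g -> ~ ltL g f.
Proof.
move=> [x [fx hx]] [y [gy hy]]; case: (wo_tri hD x y) => [xy|[e|yx]].
- by have := hx y xy; lia.
- by subst y; lia.
- by have := hy x yx; lia.
Qed.

Lemma clear_fin (f : L) t : exists l, forall x,
  (if pselect (x = t) then 0 else fn f x) <> 0 -> In x l.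
Proof. by case: (proj2_sig f) => l hl; exists l => x; case: (pselect (x = t)) => [//|n]; exact: hl. Qed.

Definition clear (f : L) t : L := exist _ _ (clear_fin f t).

Lemma clearE f t x : x <> t -> fn (clear f t) x = fn f x.
Proof. by rewrite /clear /fn /=; case: (pselect _). Qed.

Lemma clear_at f t : fn (clear f t) t = 0.
Proof. by rewrite /clear /fn /=; case: (pselect _). Qed.

(** Minimize the leading exponent t, then its coefficient, then the remainder after clearing t; the
    remainders are supported below t, so the premise applies to them. *)
Lemma min_step (Q : L -> Prop) : (exists f, Q f) ->
  (forall f t, Q f -> top f t -> forall Q', low t Q' -> (exists f, Q' f) -> has_min Q') ->
  has_min Q.
Proof.
move=> [f0 Q0] IH.
have [[f [Qf zf]]|nz] := EM (exists f, Q f /\ forall x, fn f x = 0).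
  by exists f; split=> // g _ [x []]; have := zf x; rewrite /fn; lia.
have tp f : Q f -> exists t, top f t.
  move=> Qf; apply: top_ex; apply: contrapT => n; apply: nz; exists f; split=> // x.
  by apply: contrapT => nx; apply: n; exists x.
have [t [[f1 [Qf1 tf1]] mt]] : exists t, (exists f, Q f /\ top f t) /\
    forall t', (exists f, Q f /\ top f t') -> ~ lt t' t.
  by apply: (wo_min hD); have [t ht] := tp f0 Q0; exists t, f0.
pose N n := exists f, Q f /\ top f t /\ fn f t = n.
have [n [Nn mn]] : exists n, N n /\ forall m, N m -> n <= m.
  have ex : exists n, N n by exists (fn f1 t), f1.
  case: ex => n0; elim/(well_founded_ind lt_wf): n0 => n0 IHn Nn0.
  have [[m [Nm mn0]]|no] := EM (exists m, N m /\ m < n0); first exact: IHn Nm.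
  by exists n0; split=> // m Nm; apply/Nat.nlt_ge => h; apply: no; exists m.
pose Q' f' := exists f, Q f /\ top f t /\ fn f t = n /\ f' = clear f t.
have [||f' [[f [Qf [tf [fn_ ef]]]] mf]] := IH f1 t Qf1 tf1 Q'.
- move=> _ [f [_ [tf [_ ->]]]] x; have [->|nx] := EM (x = t); first by rewrite clear_at.
  move=> /(wo_nlt hD) [//|tx]; rewrite clearE //; exact: top_zero tf tx.
- by have [f [? [? ?]]] := Nn; exists (clear f t), f.
exists f; split=> // g Qg gf; have [t' tg] := tp g Qg.
case: (wo_nlt hD (mt t' (ex_intro _ g (conj Qg tg)))) => [e|tt'].
  subst t'; have [x [gx hx]] := gf.
  have gn : n <= fn g t by apply: mn; exists g.
  have xt : x <> t by move=> e; subst x; move: gn; rewrite -fn_ /fn; lia.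
  have ltx : lt x t.
    case: (wo_nlt hD (x := t) (y := x)) => [tx|e|//]; last by case: xt.
    by move: gx; rewrite -/(fn f x) (top_zero tf tx); lia.
  have gnt : fn g t = n by rewrite -fn_; exact: hx.
  apply: (mf (clear g t)); first by exists g.
  rewrite ef; exists x; split; first by rewrite -/(fn (clear g t) x) -/(fn (clear f t) x) !clearE.
  move=> y xy; rewrite -/(fn (clear g t) y) -/(fn (clear f t) y).
  have [->|yt] := EM (y = t); first by rewrite !clear_at.
  by rewrite !clearE //; exact: hx.
have := opw_top gf tf tt'; by case: tg.
Qed.

Theorem WO_opw : WO ltL.
Proof.
split; first by move=> f h; exact: (opw_asym h h).
split.
  move=> f g h [x [fx hx]] [y [gy hy]]; case: (wo_tri hD x y) => [xy|[e|yx]].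
  - exists y; split; first by rewrite hx.
    by move=> z yz; rewrite hx ?hy //; exact: (wo_trans hD xy yz).
  - by subst y; exists x; split; [lia | move=> z xz; rewrite hx // hy].
  - exists x; split; first by rewrite -hy.
    by move=> z xz; rewrite hx ?hy //; exact: (wo_trans hD yx xz).
split.
  move=> f g; have [e|n] := EM (forall x, fn f x = fn g x).
    by right; left; exact: fn_inj.
  have [l hl] := proj2_sig f; have [l' hl'] := proj2_sig g.
  have [||x [nx mx]] := @finite_max (fun x => fn f x <> fn g x) (l ++ l').
  - move=> x nx; apply/in_or_app; have [e|h] := EM (fn f x = 0).
      by right; apply: hl' => e'; apply: nx; rewrite e; exact: (esym e').
    by left; exact: hl.
  - by apply: contrapT => nx; apply: n => x; apply: contrapT => h; apply: nx; exists x.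
  have eq y : lt x y -> fn f y = fn g y.
    by move=> xy; apply: contrapT => h; exact: (mx y h).
  rewrite /fn in nx eq; have [h|h] : fn f x < fn g x \/ fn g x < fn f x by rewrite /fn; lia.
    by left; exists x.
  by right; right; exists x; split=> // y xy; rewrite eq.
have lowmin t : forall Q, low t Q -> (exists f, Q f) -> has_min Q.
  elim/(well_founded_ind (wo_wf hD)): t => t IH Q lQ ex; apply: min_step ex _.
  move=> f t' Qf tf; apply: IH; apply: contrapT => n; apply: tf.1; exact: lQ.
move=> f; apply: contrapT => nf.
have [f0 [nf0 mf]] := min_step (ex_intro (fun f => ~ Acc ltL f) f nf) (fun f t _ _ => @lowmin t).
apply: nf0; constructor=> g gf; apply: contrapT => ng; exact: (mf g ng gf).
Qed.

Lemma zero_fin : exists l : list D, forall x, (fun _ : D => 0) x <> 0 -> In x l.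
Proof. by exists []. Qed.

Definition zero : L := exist _ _ zero_fin.

Lemma single_fin t : exists l : list D, forall x, (if pselect (x = t) then 1 else 0) <> 0 -> In x l.
Proof. by exists [t] => x; case: (pselect (x = t)) => [e|//]; left. Qed.

Definition single t : L := exist _ _ (single_fin t).

Lemma single_at t : fn (single t) t = 1.
Proof. by rewrite /single /fn /=; case: (pselect _). Qed.

Lemma singleE t x : x <> t -> fn (single t) x = 0.
Proof. by rewrite /single /fn /=; case: (pselect _). Qed.

Lemma lt_single f t : (forall x, fn f x <> 0 -> lt x t) -> ltL f (single t).
Proof.
move=> h; exists t; rewrite -!/(fn _ t) single_at; split.
  have -> : fn f t = 0 by apply: contrapT => n; exact: (wo_irr hD (h t n)).
  by lia.
move=> y ty; rewrite -!/(fn _ y) singleE; last by move=> e; subst y; exact: (wo_irr hD ty).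
by apply: contrapT => /h; exact: wo_asym.
Qed.

Lemma single_incr s t : lt s t -> ltL (single s) (single t).
Proof.
move=> st; apply: lt_single => x nx; have -> : x = s by apply: contrapT => n; apply: nx; exact: singleE.
exact: st.
Qed.

Lemma add_fin (f g : L) : exists l, forall x, fn f x + fn g x <> 0 -> In x l.
Proof.
have [l hl] := proj2_sig f; have [l' hl'] := proj2_sig g.
exists (l ++ l') => x n; apply/in_or_app.
have [e|h] := EM (fn f x = 0); [right; apply: hl' | left; exact: hl].
by rewrite -/(fn g x); lia.
Qed.

(* The natural (Hessenberg) sum *)
Definition add (f g : L) : L := exist _ _ (add_fin f g).

Lemma addE f g x : fn (add f g) x = fn f x + fn g x.
Proof. by []. Qed.

Lemma add_incr f g h : ltL f g -> ltL (add f h) (add g h).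
Proof.
move=> [x [fx hx]]; exists x; rewrite -!/(fn _ x) !addE; split.
  by rewrite /fn; lia.
by move=> y xy; rewrite -!/(fn _ y) !addE /fn hx.
Qed.

Lemma add_ge f h : ~ ltL (add f h) h.
Proof. by move=> [x []]; rewrite -!/(fn _ x) addE; lia. Qed.

Lemma support_bound f : inhabited D -> exists t, forall x, fn f x <> 0 -> ~ lt t x.
Proof.
move=> [d]; have [ex|n] := EM (exists x, fn f x <> 0).
  by have [t [_ h]] := top_ex ex; exists t.
by exists d => x nx; case: n; exists x.
Qed.

Lemma le_card_OmegaPow : le_card nat D -> le_card L D.
Proof.
move=> inf; have [l hl] := choice (fun f : L => proj2_sig f).
apply: (@le_card_trans _ (list (D * nat))).
  exists (fun f => map (fun x => (x, fn f x)) (l f)) => f g e; apply: fn_inj => x.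
  have el : l f = l g by have := f_equal (map fst) e; rewrite !map_map /= !map_id.
  have [i|n] := EM (In x (l f)).
    have : In (x, fn f x) (map (fun x => (x, fn f x)) (l f)) by exact: (in_map (fun x => (x, fn f x))).
    by rewrite e => /in_map_iff [y [[<- ->]]].
  rewrite (_ : fn f x = 0); last by apply: contrapT => h; apply: n; exact: hl.
  by symmetry; apply: contrapT => h; apply: n; rewrite el; exact: hl.
apply: le_card_trans (le_card_list _) _.
  have [f fi] := inf; exists (fun n => (f 0, n)) => x y []; by [].
exact: (le_card_trans (le_card_prod (le_card_refl D) inf) (Hessenberg inf)).
Qed.

End OmegaPower.

(** * Cases (D) and (E) *)

Lemma cf_ge_family (D K I : Type) (ltD : D -> D -> Prop) (S : I -> Prop) (f : I -> D) :
  WO ltD -> cf_ge ltD K -> (forall x, exists i, S i /\ ~ ltD (f i) x) ->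
  le_card K {i | S i}.
Proof.
move=> hD cf cof; apply: (@le_card_trans _ {x | exists i, S i /\ f i = x}).
  apply: cf => x; have [i [Si fx]] := cof x; exists (f i); split; first by exists i.
  by case: (wo_nlt hD fx) => [->|h]; [right | left].
by apply: (surj_on_le_card (f := f)).
Qed.

Lemma regular_of_cofinality (D K : Type) (ltD : D -> D -> Prop) (ltK : K -> K -> Prop) (c : K -> D) :
  WO ltD -> initial_ordinal ltK -> lt_card nat K -> cf_ge ltD K ->
  (forall i j, ltK i j -> ltD (c i) (c j)) -> (forall x, exists i, ~ ltD (c i) x) ->
  regular ltK /\ small ltK (fun _ : nat => True).
Proof.
move=> hD [hK init] [inf ninf] cf ci cc.
have [e0 e0i] := inf.
have bd (I : Type) (S : I -> Prop) (f : I -> K) : ~ le_card K {i | S i} ->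
    exists b, forall i, S i -> ltK (f i) b.
  move=> n; apply: contrapT => nb; apply: n.
  apply: (cf_ge_family (f := fun i => c (f i)) hD cf) => x; have [k kx] := cc x.
  have [i [Si nf]] : exists i, S i /\ ~ ltK (f i) k.
    apply: contrapT => n; apply: nb; exists k => i Si; apply: contrapT => nf; apply: n.
    by exists i.
  exists i; split=> //; apply: (wo_le_trans hD kx).
  by case: (wo_nlt hK nf) => [->|/ci]; [exact: wo_irr | exact: wo_asym].
have segn a : ~ le_card K {b | ltK b a} by have [_] := init a.
split; last by move=> f; apply: bd => h; apply: ninf; exact: le_card_trans h (le_card_sigT _).
split=> //.
- by exists; exact: (e0 0).
- move=> x; have [|b hb] := bd unit (fun=> True) (fun=> x); last by exists b; exact: (hb tt).
  move=> h; have [s si] := le_card_trans inf h.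
  suff : 0 = 1 by []; apply: si; apply: sig_eq; by case: (sval (s 0)) (sval (s 1)) => [] [].
- by move=> a f; exact: bd.
Qed.

Section Transfer.
Variables (D : Type) (ltD : D -> D -> Prop) (hD : WO ltD).
Variables (K : Type) (ltK : K -> K -> Prop) (rK : regular ltK).
Hypothesis unc : small ltK (fun _ : nat => True).
Hypothesis inf : le_card nat K.
Hypothesis KD : le_card K D.
Hypothesis H2k : eq_card (K -> Prop) (D -> Prop).
Hypothesis H2lt : two_lt_eq ltK \/ two_pow_succ K.
Notation L := (OmegaPow ltD).
Notation ltL := (opw_lt ltD).
Let hL : WO ltL := WO_opw hD.
Variable blk : L -> K.
Hypothesis blk_mono : forall x y, ltL x y -> ~ ltK (blk y) (blk x).
Hypothesis blk_onto : forall i, exists x, blk x = i.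
Hypothesis blk_embed : forall i i' h, ~ ltK i' i -> blk h = i' -> exists f : L -> L,
  (forall x y, blk x = i -> blk y = i -> ltL x y -> ltL (f x) (f y)) /\
  forall x, blk x = i -> blk (f x) = i' /\ ~ ltL (f x) h.
Hypothesis blk_cof : forall i,
  (exists h, blk h = i /\ forall x, blk x = i -> ~ ltL h x) \/
  forall j0 (f : K -> L), (forall j, ~ ltK j0 j -> blk (f j) = i) ->
    exists h, blk h = i /\ forall j, ~ ltK j0 j -> ltL (f j) h.

Lemma copy_positive (A : L -> Prop) : ord_iso (restr ltL A) ltL <-> positive ltL A.
Proof.
split=> [[f [fi [fs fo]]]|[f [fi fA]]]; last exact: (ord_iso_of_embedding hL fi fA).
have [h hP] := choice fs; exists (fun x => sval (h x)); split; last by move=> x; exact: proj2_sig.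
move=> x y; rewrite -{1}(hP x) -{1}(hP y); exact: (fo _ _).2.
Qed.

Theorem block_collapse : cba_iso (sq (Pomega ltD)) (ColPoset (D -> Prop)).
Proof.
have [C [Code [Cdisj Crich]]] := codes_exist rK unc inf H2lt.
have pos (p : car (Pomega ltD)) : positive ltL (sval p) by apply/copy_positive; exact: (proj2_sig p).
pose code n (p : car (Pomega ltD)) c := exists Y, Code n Y c /\ forall x, sval p x -> Y (blk x).
have topI : ord_iso (restr ltL (fun=> True)) ltL by apply/copy_positive; exists id.
pose copy A := ord_iso (restr ltL A) ltL.
pose top : car (Pomega ltD) := exist copy _ topI.
apply: (@sq_cba_iso_Col (Pomega ltD) (D -> Prop) C top code).
- by move=> p x.
- by move=> p q r pq qr x /pq /qr.
- by [].
- apply: le_card_trans (le_card_sigT _) _; apply: le_card_pow.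
  exact: (le_card_OmegaPow ltD (le_card_trans inf KD)).
- by move=> n p q c qp [Y [CY pY]]; exists Y; split=> // x /qp /pY.
- move=> n p c c' [Y [CY pY]] [Y' [CY' pY']]; apply: contrapT => nc.
  apply: (positive_unbounded hL rK blk_mono blk_onto blk_embed blk_cof (pos p)
    (a := fun x => Y x /\ Y' x) _ (Cdisj _ _ _ _ _ CY CY' nc)).
  by move=> x px; split; [exact: pY | exact: pY'].
- move=> p; have [Y [uY trY]] := positive_trace hL rK unc blk_mono blk_onto blk_embed blk_cof (pos p).
  have [n hn] := Crich Y uY; exists n.
  apply: le_card_trans (eq_card_ge H2k) (le_card_trans hn _).
  apply: le_card_sub => c [Z [ZY [uZ CZ]]].
  have pA := trY Z uZ ZY.
  exists (exist copy _ ((copy_positive _).2 pA)); split; first by move=> x [].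
  by exists Z; split=> // x [].
Qed.

End Transfer.

Lemma seg_le_card (K : Type) (ltK : K -> K -> Prop) j0 : regular ltK -> initial_ordinal ltK ->
  ~ le_card K {j | ~ ltK j0 j}.
Proof.
move=> rK [hK init] h; have [a ja] := rg_next rK j0.
have [_] := init a; apply; apply: le_card_trans h _; apply: le_card_sub => j n.
exact: (wo_le_lt hK n ja).
Qed.

Theorem collapse_caseE (D : Type) (ltD : D -> D -> Prop) (K : Type) (ltK : K -> K -> Prop) :
  WO ltD -> is_cof ltD ltK -> caseE ltD ltK -> eq_card (K -> Prop) (D -> Prop) ->
  two_lt_eq ltK \/ two_pow_succ K -> cba_iso (sq (Pomega ltD)) (ColPoset (D -> Prop)).
Proof.
move=> hD [init [cf _]] [nK [q [qi [qc qcf]]]] H2k H2lt.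
have [rK unc] : regular ltK /\ small ltK (fun _ : nat => True).
  apply: (regular_of_cofinality hD init nK cf qi) => x; have [i xi] := qc x.
  by exists i; exact: wo_asym.
have hK := rg_wo rK; have inf := nK.1.
have KD : le_card K D by exists q; exact: (incr_inj hK (wo_irr hD) qi).
have iD : inhabited D by have [k] := rg_pt rK; exists; exact: (q k).
pose within (x : OmegaPow ltD) j := forall t, fn x t <> 0 -> ltD t (q j).
have ex x : exists j, within x j /\ forall j', within x j' -> ~ ltK j' j.
  apply: (wo_min hK); have [t ht] := support_bound hD x iD; have [j tj] := qc t.
  by exists j => y /ht ny; exact: (wo_le_lt hD ny tj).
have [blk blkP] := choice ex.
have blkE x i : within x i -> (forall j, ltK j i -> ~ within x j) -> blk x = i.
  move=> h1 h2; apply: (wo_le_antisym hK) => l; first exact: ((blkP x).2 i h1 l).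
  exact: (h2 _ l (blkP x).1).
have not_within x j : ltK j (blk x) -> ~ within x j.
  by move=> l h; exact: ((blkP x).2 j h l).
have wm x y j : opw_lt ltD x y -> within y j -> within x j.
  move=> [t [xt ht]] wy s ns; have tj : ltD t (q j) by apply: wy; rewrite /fn; lia.
  have [ts|nts] := EM (ltD t s); last exact: (wo_le_lt hD nts tj).
  by apply: wy; rewrite /fn -ht.
have bm x y : opw_lt ltD x y -> ~ ltK (blk y) (blk x).
  by move=> xy l; apply: (not_within _ _ l); apply: wm xy (blkP y).1.
have q0 i : exists t, ltD t (q i).
  apply: contrapT => n; have [|f _] := (qcf i).1 (fun=> False).
    by move=> [t ti]; case: n; exists t.
  by have [k] := rg_pt rK; case: (f k).
have fam i (I : Type) (S : I -> Prop) (f : I -> D) : ~ le_card K {i | S i} ->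
    (forall j, S j -> ltD (f j) (q i)) -> exists t, ltD t (q i) /\ forall j, S j -> ltD (f j) t.
  move=> nS fq; apply: contrapT => n; apply: nS; have [t0 t0q] := q0 i.
  have e j : exists u : {y | ltD y (q i)}, S j -> sval u = f j.
    have [Sj|nSj] := EM (S j); first by exists (exist (fun y => ltD y (q i)) _ (fq j Sj)).
    by exists (exist (fun y => ltD y (q i)) t0 t0q).
  have [f' f'P] := choice e.
  apply: (cf_ge_family (f := f') (WO_sig (fun y => ltD y (q i)) hD) (qcf i).1) => -[t ti].
  have [j [Sj nf]] : exists j, S j /\ ~ ltD (f j) t.
    apply: contrapT => nj; apply: n; exists t; split=> // j Sj; apply: contrapT => h.
    by apply: nj; exists j.
  by exists j; split=> //; rewrite /restr (f'P j Sj).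
have ws t j : within (single ltD t) j <-> ltD t (q j).
  split=> [h|h s ns]; first by apply: h; rewrite single_at.
  by have -> : s = t by apply: contrapT => n; apply: ns; exact: singleE.
apply: (block_collapse hD rK unc inf KD H2k H2lt bm).
- move=> i; have [|j|t [ti qt]] := fam i K (fun j => ltK j i) q; first exact: (init.2 i).2.
    exact: qi.
  exists (single ltD t); apply: blkE; first exact/ws.
  by move=> j /qt jt /ws; exact: wo_asym.
- move=> i i' h ii' bh; exists (fun x => add x h); split.
    by move=> x y _ _; exact: add_incr.
  move=> x bx; split; last exact: add_ge.
  apply: blkE => [t|j ji' w].
    rewrite addE => n; have [e|nh] := EM (fn h t = 0); last first.
      by rewrite -bh; apply: (blkP h).1.
    have tx : ltD t (q i) by rewrite -bx; apply: (blkP x).1; lia.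
    by case: (wo_nlt hK ii') => [->|/qi h'] //; exact: (wo_trans hD tx h').
  apply: (not_within h j); first by rewrite bh.
  by move=> t nh; apply: w; rewrite addE; lia.
- move=> i; right=> j0 f fb.
  pose S (jt : K * D) := ~ ltK j0 jt.1 /\ top (f jt.1) jt.2.
  have [||t [ti ft]] := fam i (K * D)%type S snd.
  + move=> h; apply: (seg_le_card (j0 := j0) rK init); apply: le_card_trans h _.
    apply: (@le_card_sig _ _ _ _ fst) => [[j t] [] //|[j t] [j' t'] [_ [n1 m1]] [_ [n2 m2]] /= e].
    subst j'; congr pair; apply: (wo_le_antisym hD); [exact: m2 | exact: m1].
  + by move=> [j t] [/= nj [nt _]]; rewrite -(fb j nj); apply: (blkP (f j)).1.
  have lt j : ~ ltK j0 j -> opw_lt ltD (f j) (single ltD t).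
    move=> nj; apply: (lt_single hD) => x nx.
    have [t' t't] := top_ex hD (ex_intro _ x nx).
    exact: (wo_le_lt hD (t't.2 x nx) (ft (j, t') (conj nj t't))).
  exists (single ltD t); split=> //; apply: blkE; first exact/ws.
  move=> j ji w; have n0 := wo_irr hK (x := j0).
  apply: (not_within (f j0) j); first by rewrite fb.
  exact: wm (lt j0 n0) w.
Qed.

Lemma small_low (K : Type) (ltK : K -> K -> Prop) k : regular ltK ->
  small ltK (fun _ : nat => True) ->
  small ltK (fun g : OmegaPow ltK => forall x, ltK k x -> fn g x = 0).
Proof.
move=> rK unc; have hK := rg_wo rK.
pose low k (g : OmegaPow ltK) := forall x, ltK k x -> fn g x = 0.
pose put k n (g g' : OmegaPow ltK) :=
  fn g' k = n /\ forall x, x <> k -> fn g' x = fn g x.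
elim/(well_founded_ind (wo_wf hK)): k => k IH.
have sput n k' (S : OmegaPow ltK -> Prop) : small ltK S -> small ltK (fun g' => exists g, S g /\ put k' n g g').
  move=> sS; apply: small_sub (small_bigcup rK (L := put k' n) sS _) _ => //.
  move=> g _ f; have [[g0 p0]|no] := EM (exists g', put k' n g g'); last first.
    by have [b] := rg_pt rK; exists b => g' p; case: no; exists g'.
  have [b hb] := rg_next rK (f g0); exists b => g' p.
  suff -> : g' = g0 by [].
  apply: fn_inj => x; have [->|nx] := EM (x = k'); first by rewrite p.1 p0.1.
  by rewrite (p.2 x nx) (p0.2 x nx).
pose below (g : OmegaPow ltK) := g = zero ltK \/ exists k', ltK k' k /\ low k' g.
have sb : small ltK below.
  have s1 := small_bigcup rK (small_seg rK k) (L := low) IH.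
  move=> f; have [b hb] := s1 f; have [c [bc zc]] := succ_strict rK b (f (zero ltK)).
  by exists c => g [->//|/hb h]; exact: (wo_trans hK h bc).
apply: small_sub (small_bigcup rK (S := fun _ : nat => True)
   (L := fun n g' => exists g, below g /\ put k n g g') unc _) _.
  by move=> n _; exact: sput.
move=> g hg; exists (fn g k); split=> //; exists (clear g k); split; last first.
  by split=> // x nx; rewrite clearE.
have [ex|no] := EM (exists x, fn (clear g k) x <> 0).
  right; have [t tt] := top_ex hK ex; exists t; split; last by move=> x tx; exact: (top_zero tt tx).
  have tk : t <> k by move=> e; subst t; case: tt => + _; rewrite clear_at.
  apply: contrapT => /(wo_nlt hK) [//|kt].
  by case: tt => + _; rewrite clearE // hg.
left; apply: fn_inj => x; apply: contrapT => nx; apply: no; by exists x.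
Qed.

Theorem omega_pow_initial (K : Type) (ltK : K -> K -> Prop) :
  regular ltK -> small ltK (fun _ : nat => True) ->
  exists f : OmegaPow ltK -> K, (forall x y, opw_lt ltK x y -> ltK (f x) (f y)) /\
    forall k, exists x, f x = k.
Proof.
move=> rK unc; have hK := rg_wo rK; have hL := WO_opw hK.
case: (wo_compare hK hL) => [[f [fi fd]]|[a [G [Gi [Ga _]]]]]; last first.
  exfalso; apply: (incr_ge hK (f := fun k => G (single ltK k)) _ (Ga (single ltK a))).
  by move=> x y xy; apply: Gi; exact: single_incr.
have onto g0 : exists k, f k = g0.
  apply: contrapT => n.
  have lt k : opw_lt ltK (f k) g0.
    by case: (wo_tri hL (f k) g0) => [//|[e|/fd e]] //; case: n; exists k.
  have [k0] := rg_pt rK.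
  have [t tt] : exists t, top g0 t.
    apply: (top_ex hK); have [x [gx _]] := lt k0; exists x; rewrite /fn; lia.
  have e g : exists k, forall k', f k' = g -> k = k'.
    have [[k fk]|no] := EM (exists k, f k = g).
      by exists k => k' fk'; apply: (incr_inj hK (wo_irr hL) fi); rewrite fk fk'.
    by exists k0 => k' fk'; case: no; exists k'.
  have [F FP] := choice e; have [b hb] := small_low t rK unc F.
  apply: (wo_irr hK (x := b)); rewrite -{1}(FP (f b) b erefl); apply: hb => x tx.
  exact: (opw_top hK (lt b) tt tx).
have [h hP] := choice onto; exists h; split.
  move=> x y xy; case: (wo_tri hK (h x) (h y)) => [//|[e|/fi]].
    by case: (wo_irr hL (x := x)); rewrite -{2}(hP x) e hP.
  by rewrite !hP => yx; case: (wo_asym hL xy).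
by move=> k; exists (f k); apply: (incr_inj hK (wo_irr hL) fi); exact: hP.
Qed.

Theorem collapse_caseD (D : Type) (ltD : D -> D -> Prop) (K : Type) (ltK : K -> K -> Prop) :
  WO ltD -> is_cof ltD ltK -> caseD ltD ltK -> eq_card (K -> Prop) (D -> Prop) ->
  two_lt_eq ltK \/ two_pow_succ K -> cba_iso (sq (Pomega ltD)) (ColPoset (D -> Prop)).
Proof.
move=> hD [init [cf _]] [nK [Th [ltT [hT [[u [ui [us uo]]] cT]]]]] H2k H2lt.
have inf := nK.1; have [c0 _] := inf.
have [rK unc] : regular ltK /\ small ltK (fun _ : nat => True).
  apply: (regular_of_cofinality (c := fun k => u (inr k)) hD init nK cf).
    by move=> i j ij; apply/uo.
  move=> x; have [[t|k] <-] := us x.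
    by exists (c0 0) => /uo.
  by exists k; exact: wo_irr.
have hK := rg_wo rK.
have KD : le_card K D by exists (fun k => u (inr k)) => x y /ui [].
have [v vP] := choice us.
have vu z : v (u z) = z by apply: ui; exact: vP.
have finK (g : OmegaPow ltD) : exists l, forall k, fn g (u (inr k)) <> 0 -> In k l.
  have [l hl] := proj2_sig g.
  exists (flat_map (fun x => match v x with inr k => [k] | inl _ => [] end) l) => k /hl h.
  by apply/in_flat_map; exists (u (inr k)); split=> //; rewrite vu; left.
have finT (g : OmegaPow ltD) : exists l, forall t, fn g (u (inl t)) <> 0 -> In t l.
  have [l hl] := proj2_sig g.
  exists (flat_map (fun x => match v x with inl t => [t] | inr _ => [] end) l) => k /hl h.
  by apply/in_flat_map; exists (u (inl k)); split=> //; rewrite vu; left.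
pose pK g : OmegaPow ltK := exist _ _ (finK g).
pose pT g : OmegaPow ltT := exist _ _ (finT g).
have fin2 (a : OmegaPow ltT) (m : OmegaPow ltK) : exists l, forall x,
    match v x with inl t => fn a t | inr k => fn m k end <> 0 -> In x l.
  have [l hl] := proj2_sig a; have [l' hl'] := proj2_sig m.
  exists (map (fun t => u (inl t)) l ++ map (fun k => u (inr k)) l') => x n.
  apply/in_or_app; case e: (v x) n => [t|k] n.
    by left; rewrite -(vP x) e; apply: (in_map (fun t => u (inl t))); exact: hl.
  by right; rewrite -(vP x) e; apply: (in_map (fun k => u (inr k))); exact: hl'.
pose mk a m : OmegaPow ltD := exist _ _ (fin2 a m).
have pKmk a m : pK (mk a m) = m by apply: fn_inj => k; rewrite /fn /= vu.
have pTmk a m : pT (mk a m) = a by apply: fn_inj => k; rewrite /fn /= vu.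
have ext g h : pK g = pK h -> pT g = pT h -> g = h.
  move=> eK eT; apply: fn_inj => x; rewrite -(vP x); case: (v x) => [t|k].
    exact: (f_equal (fun a => fn a t) eT).
  exact: (f_equal (fun a => fn a k) eK).
have ltE g h : opw_lt ltD g h <->
    opw_lt ltK (pK g) (pK h) \/ pK g = pK h /\ opw_lt ltT (pT g) (pT h).
  split=> [[x [gx hx]]|[[k [gk hk]]|[e [t [gt ht]]]]].
  - move: gx hx; rewrite -(vP x); case: (v x) => [t|k] gx hx.
      right; split; first by apply: fn_inj => k; apply: hx; apply/uo.
      by exists t; split=> // y ty; apply: hx; apply/uo.
    by left; exists k; split=> // y ky; apply: hx; apply/uo.
  - exists (u (inr k)); split=> // y; rewrite -(vP y); case: (v y) => [t|k'] /uo //=; exact: hk.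
  - exists (u (inl t)); split=> // y; rewrite -(vP y); case: (v y) => [t'|k'] /uo /=.
      exact: ht.
    by move=> _; exact: (f_equal (fun a => fn a k') e).
have [tau [ti ts]] := omega_pow_initial rK unc.
have hLK := WO_opw hK.
have tinj := incr_inj hLK (wo_irr hK) ti.
apply: (block_collapse hD rK unc inf KD H2k H2lt (blk := fun g => tau (pK g))).
- move=> x y /ltE [/ti h|[-> _]]; [exact: wo_asym | exact: wo_irr].
- by move=> i; have [m <-] := ts i; exists (mk (zero ltT) m); rewrite pKmk.
- move=> i i' h _ bh; exists (fun x => mk (add (pT x) (pT h)) (pK h)); split.
    move=> x y bx by_ /ltE [/ti|[_ xy]]; first by rewrite bx by_ => /(wo_irr hK).
    apply/ltE; right; rewrite !pKmk !pTmk; split=> //; exact: add_incr.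
  move=> x _; rewrite pKmk; split=> // /ltE; rewrite pKmk pTmk => -[h'|[_ h']].
    exact: (wo_irr hLK h').
  exact: (add_ge h').
- move=> i; case: cT => [noT|cT].
    left; have [m <-] := ts i; exists (mk (zero ltT) m); rewrite pKmk; split=> // x /tinj ex.
    move=> /ltE; rewrite pKmk ex => -[h'|[_ [t _]]]; last by case: (noT t).
    exact: (wo_irr hLK h').
  right=> j0 f fb.
  pose S (jt : K * Th) := ~ ltK j0 jt.1 /\ top (pT (f jt.1)) jt.2.
  have nS : ~ le_card K {jt | S jt}.
    move=> h; apply: (seg_le_card (j0 := j0) rK init); apply: le_card_trans h _.
    apply: (@le_card_sig _ _ _ _ fst) => [[j t] [] //|[j t] [j' t'] [_ [n1 m1]] [_ [n2 m2]] /= e].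
    subst j'; congr pair; apply: (wo_le_antisym hT); [exact: m2 | exact: m1].
  have [t0 ht0] : exists t0, forall jt, S jt -> ltT jt.2 t0.
    apply: contrapT => n; apply: nS; apply: (cf_ge_family (f := snd) hT cT) => t.
    apply: contrapT => nt; apply: n; exists t => jt Sjt; apply: contrapT => h; apply: nt.
    by exists jt.
  exists (mk (single ltT t0) (pK (f j0))); rewrite pKmk; split.
    by apply: fb; exact: (wo_irr hK).
  move=> j nj; apply/ltE; right; rewrite pKmk pTmk; split.
    by apply: tinj; rewrite (fb j nj) (fb j0 (wo_irr hK (x := j0))).
  apply: (lt_single hT) => x nx.
  have [t' t't] := top_ex hT (ex_intro _ x nx).
  exact: (wo_le_lt hT (t't.2 x nx) (ht0 (j, t') (conj nj t't))).
Qed.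

Theorem mainTheorem14 (D : Type) (ltD : D -> D -> Prop) (K : Type) (ltK : K -> K -> Prop)
  (HD : WO ltD) (HK : is_cof ltD ltK)
  (Hcase : caseD ltD ltK \/ caseE ltD ltK)
  (H2k : eq_card (K -> Prop) (D -> Prop))
  (H2lt : two_lt_eq ltK \/ two_pow_succ K) :
  cba_iso (sq (Pomega ltD)) (ColPoset (D -> Prop)).
Proof.
by case: Hcase => h; [exact: collapse_caseD HK h H2k H2lt | exact: collapse_caseE HK h H2k H2lt].
Qed.
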